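(* Let $q_1,q_2\ge 0$ and $s\ge 1$ be integers, and let $d=q_1+q_2+s$. Then the generating series $A^{(q_1,q_2;s)}(x)$ (defined in the context) is given by $$A^{(q_1,q_2;s)}(x)=\sum_{t_1=0}^{q_1+s}\sum_{t_2=0}^{q_2+s}\frac{(d-t_1)!\,(d-t_2)!\,(2q_1+s)!\,(2q_2+s)!}{2^{t_1+t_2}\,t_1!\,t_2!\,(d-t_1-t_2)!}\binom{x}{d-t_1-t_2+1}\left[\frac{1}{q_1!\,q_2!\,(s+q_1-t_1)!\,(s+q_2-t_2)!}-\frac{1}{(q_1+s)!\,(q_2+s)!\,(q_1-t_1)!\,(q_2-t_2)!}\right].$$
   Context: For a positive integer $p$ and a label $n$, let $[p]^{\underline n}=\{1^{\underline n},\dots,p^{\underline n}\}$ be a copy of $\{1,\dots,p\}$ labelled by $n$. For positive integers $p_1,p_2$ let $[p_1,p_2]=[p_1]^{\underline 1}\cup[p_2]^{\underline 2}$ (a disjoint union). A pairing of a finite set is a partition of it into subsets of size 2, identified with the corresponding fixed-point free involution. A pair $\{x^{\underline i},y^{\underline k}\}$ of a pairing of $[p_1,p_2]$ is mixed if $i\ne k$ and non-mixed otherwise. Put $p_i=2q_i+s$ for $i=1,2$. Let $\mathcal P^{(q_1,q_2;s)}$ be the set of pairings of $[p_1,p_2]$ having exactly $q_i$ non-mixed pairs of the form $\{x^{\underline i},y^{\underline i}\}$ for each $i=1,2$, and exactly $s$ mixed pairs. Let $\gamma_{p_1,p_2}=(1^{\underline 1},\dots,p_1^{\underline 1})(1^{\underline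 2},\dots,p_2^{\underline 2})$, a permutation of $[p_1,p_2]$. Let $a_L^{(q_1,q_2;s)}$ be the number of $\mu\in\mathcal P^{(q_1,q_2;s)}$ such that the permutation $\mu\gamma_{p_1,p_2}^{-1}$ has exactly $L$ cycles (fixed points counted as cycles). The generating series is the polynomial $A^{(q_1,q_2;s)}(x)=\sum_{L\ge1}a_L^{(q_1,q_2;s)}x^L$. Conventions: $\binom{x}{k}=x(x-1)\cdots(x-k+1)/k!$ as a polynomial in $x$, and $1/m!$ is interpreted as $0$ when $m$ is a negative integer (so a summand with $d-t_1-t_2<0$ is $0$). *)

(* Defs.v *)
From HB Require Import structures.
From mathcomp Require Import all_boot all_order all_algebra all_fingroup.

Set Implicit Arguments.
Unset Strict Implicit.
Unset Printing Implicit Defensive.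

Import GRing.Theory.
Local Open Scope ring_scope.

(* The disjoint union [p1, p2]: x^1 is [inl i] and x^2 is [inr i], where i is
   the ordinal with value x - 1. *)
Definition points (p1 p2 : nat) : finType := ('I_p1 + 'I_p2)%type.

Definition label (p1 p2 : nat) (z : points p1 p2) : nat :=
  match z with inl _ => 1%N | inr _ => 2%N end.

Section Pairings.
Variable T : finType.

Definition is_pairing (mu : {perm T}) : bool :=
  [forall z, (mu z != z) && (mu (mu z) == z)].

Definition pairs (mu : {perm T}) : {set {set T}} :=
  [set [set z; mu z] | z : T].

Lemma pairs_partition (mu : {perm T}) :
  is_pairing mu ->
  partition (pairs mu) [set: T] /\ {in pairs mu, forall B : {set T}, #|B| = 2%N}.
Proof.
move/forallP => muP.
have muK z : mu (mu z) = z by have /andP[_ /eqP] := muP z.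
have mu_neq z : mu z != z by have /andP[] := muP z.
have memE y z : (y \in [set z; mu z]) -> [set z; mu z] = [set y; mu y].
  by rewrite !inE => /orP[] /eqP -> //; rewrite muK setUC.
split; last by move=> B /imsetP[z _ ->]; rewrite cards2 eq_sym mu_neq.
apply/and3P; split.
- apply/eqP/setP => z; rewrite inE; apply/bigcupP.
  by exists [set z; mu z]; [exact: imset_f | rewrite !inE eqxx].
- apply/trivIsetP => B C /imsetP[y _ ->] /imsetP[z _ ->].
  apply: contraR; case/pred0Pn => w /= /andP[wy wz].
  by rewrite (memE _ _ wy) (memE _ _ wz).
- by apply/imsetP => -[z _ /setP/(_ z)]; rewrite !inE eqxx.
Qed.

End Pairings.

Section TwoLabels.
Variables p1 p2 : nat.

Definition nonmixed_pairs (mu : {perm points p1 p2}) (i : nat) :=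
  [set B in pairs mu | [forall z in B, label z == i]].

Definition mixed_pairs (mu : {perm points p1 p2}) :=
  [set B in pairs mu | [exists y in B, exists z in B, label y != label z]].

Definition gamma_fun (z : points p1 p2) : points p1 p2 :=
  match z with inl i => inl (ordS i) | inr i => inr (ordS i) end.

Lemma gamma_fun_inj : injective gamma_fun.
Proof.
by move=> [i|i] [j|j] //= [eq_ij]; congr (_ _); apply/ordS_inj/val_inj.
Qed.

Definition gamma : {perm points p1 p2} := perm gamma_fun_inj.

End TwoLabels.

Definition pairing_set (q1 q2 s : nat) :
    {set {perm points (2 * q1 + s) (2 * q2 + s)}} :=
  [set mu | [&& is_pairing mu,
             #|nonmixed_pairs mu 1| == q1,
             #|nonmixed_pairs mu 2| == q2
           & #|mixed_pairs mu| == s]].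

(* [perm] products compose left to right, so the permutation
   z |-> mu (gamma^-1 z) is written gamma^-1 * mu. *)
Definition coef_a (q1 q2 s L : nat) : nat :=
  #|[set mu in pairing_set q1 q2 s |
      #|porbits ((gamma (2 * q1 + s) (2 * q2 + s))^-1 * mu)%g| == L]|.

(* A permutation of p1 + p2 points has at most p1 + p2 cycles, so the sum over
   all L >= 1 can be truncated there. *)
Definition gen_series (q1 q2 s : nat) : {poly rat} :=
  \sum_(1 <= L < ((2 * q1 + s) + (2 * q2 + s)).+1)
     (coef_a q1 q2 s L)%:R *: 'X^L.

Lemma coef_a_large (q1 q2 s L : nat) :
  ((2 * q1 + s) + (2 * q2 + s) < L)%N -> coef_a q1 q2 s L = 0%N.
Proof.
move=> ltL; apply/eqP; rewrite cards_eq0; apply/eqP/setP => mu.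
rewrite !inE; apply/negbTE; rewrite negb_and; apply/orP; right.
rewrite neq_ltn; apply/orP; left; apply: leq_ltn_trans ltL.
by rewrite (leq_trans (leq_imset_card _ _)) // card_sum !card_ord.
Qed.

Lemma coef_gen_series (q1 q2 s L : nat) :
  (0 < L)%N -> (gen_series q1 q2 s)`_L = (coef_a q1 q2 s L)%:R.
Proof.
move=> L0; rewrite /gen_series coef_sum.
under eq_bigr => i _ do rewrite coefZ coefXn.
case: (ltnP L ((2 * q1 + s) + (2 * q2 + s)).+1) => hL; last first.
  rewrite coef_a_large // big_nat big1 // => i /andP[_ hi].
  by rewrite gtn_eqF ?mulr0 // (leq_trans hi hL).
rewrite (bigD1_seq L) /= ?mem_index_iota ?L0 ?iota_uniq //.
rewrite eqxx mulr1 big1 ?addr0 // => i /negbTE; rewrite eq_sym => ->.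
by rewrite mulr0.
Qed.

(* 1 / m!, read as 0 for m < 0. *)
Definition inv_fact (m : int) : rat :=
  match m with Posz n => (n`!%:R)^-1 | Negz _ => 0 end.

Definition binom_poly (k : nat) : {poly rat} :=
  (k`!%:R)^-1 *: \prod_(i < k) ('X - (i%:R)%:P).

(* Main.v *)
Require Import Defs.
From HB Require Import structures.
From mathcomp Require Import all_boot all_order all_algebra all_fingroup.
From mathcomp Require Import ring lra zify.

Set Implicit Arguments.
Unset Strict Implicit.
Unset Printing Implicit Defensive.

Import GRing.Theory Num.Theory.
Local Open Scope ring_scope.

(* Fix a rational number x and give a permutation the weight x ^ (number of
   cycles).  For a row R of p points with a chosen root z, summing a function
   over the p-cycles of R amounts, up to the factor p, to taking the alternating
   sum over B in R \ z of the hook Young symmetrizers Sym(R \ B) Sgn(z + B).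
   If z belongs to a mixed pair, a non-mixed pair {u, v} of the row can be
   deleted from these symmetrizers: with b = |B| and a = |R| - |B| - 1 taken
   after the deletion, it contributes (x+a+1)(x+a+2) when u and v were both
   outside B, -(x-b-1)(x-b-2) when both were in B, and 0 otherwise.  Once only
   mixed pairs remain, the pairing transports the second row to the first, where
   symmetrizers of distinct B are orthogonal and each one is idempotent up to a
   factor, its weight being the product of the contents x+i and x-i of the hook.
   This yields A(N) = T(N) + ... + T(N+s-1), where T(M) is proportional to
   h_1(M) h_2(M) / (M (M-1) ... (M-s+1)) and h_i(M) is the coefficient of
   w^(q_i+s) in (1+w)^M (1+w/2)^(q_i).  Expanding
   (1+w)(1+v) = 1 + v(1+w/2) + w(1+v/2) in h_1 h_2 shows that the two halves of
   the bracket in the formula are antidifferences of T(N+s) and of T(N). *)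

(** * Signed sums over symmetric groups *)

(** Hooks appear because a full cycle of a row has nonzero character only on hook shapes, where the
    value is a sign given by the leg length. The two cycles of [gamma] may be replaced by sums over
    all full cycles of each row, because the set of pairings is stable under conjugation by
    permutations preserving both rows; every pairing then contributes the same amount, and only the
    number of pairings enters. The obstacle is that a pairing couples the rows, so the sum does not
    factor into characters; a root on a mixed pair stays in place while all non-mixed pairs are
    deleted. Multiplied by the contents of the remaining hook, a deletion becomes a difference u(b)
    - u(b+2), and after q deletions (1+w)^2 - 1 = 2w(1+w/2) produces the factor (1+w/2)^q of h_i.
    Each h_i carries a copy of the content product, while the hook sum contains it once for both
    rows together: hence the denominator M(M-1)...(M-s+1). The quotient is controlled only where
    this is nonzero, so polynomials are compared at integers N >= s. *)

Lemma set_insert_ind (T : finType) (P : {set T} -> Prop) :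
  P set0 -> (forall v (A : {set T}), v \notin A -> P A -> P (v |: A)) -> forall A, P A.
Proof.
move=> P0 PS A; elim: {A}_.+1 {-2}A (ltnSn #|A|) => // n IH A ltA.
have [->//|/set0Pn[v vA]] := eqVneq A set0.
rewrite -(setD1K vA); apply: PS; first by rewrite setD11.
by apply: IH; rewrite (cardsD1 v) vA in ltA.
Qed.

Lemma big_subsetU1 (T : finType) (V : nmodType) (v : T) (A : {set T}) (f : {set T} -> V) :
  v \notin A ->
  \sum_(B : {set T} | B \subset v |: A) f B =
  \sum_(B : {set T} | B \subset A) (f B + f (v |: B)).
Proof.
move=> vA; rewrite (bigID (fun B : {set T} => v \in B)) /= addrC big_split /=.
congr (_ + _).
  apply: eq_bigl => B; apply/andP/idP => [[sB vB]|sB].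
    by rewrite -(setU1K vA) subsetD1 sB vB.
  by split; [exact: subset_trans (subsetUr _ _)|apply: contra vA => /(subsetP sB)].
rewrite (reindex_onto (fun B => v |: B) (fun B => B :\ v)) /=; last first.
  by move=> B /andP[_ vB]; rewrite setD1K.
apply: eq_bigl => B; rewrite setU11 andbT.
apply/andP/idP => [[sB /eqP eB]|sB].
  have vB : v \notin B by rewrite -eB setD11.
  by rewrite -eB -(setU1K vA) setSD.
have vB : v \notin B by apply: contra vA => /(subsetP sB).
by rewrite setU1K // eqxx setUS.
Qed.

Section SignedSums.
Variable T : finType.
Implicit Types (X Y R : {set T}) (s t h r : {perm T}) (F G : {perm T} -> rat).

(* The trivial character for [e = false], the signature for [e = true]. *)
Definition sgn (e : bool) s : rat := (-1) ^+ (e && odd_perm s).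

Lemma sgnM e s t : sgn e (s * t)%g = sgn e s * sgn e t.
Proof.
by rewrite /sgn odd_permM; case: e; rewrite ?signr_addb ?mulr1.
Qed.

Lemma sgnV e s : sgn e s^-1%g = sgn e s.
Proof. by rewrite /sgn odd_permV. Qed.

Lemma sgnJ e s h : sgn e (s ^ h)%g = sgn e s.
Proof. by rewrite /sgn odd_permJ. Qed.

Lemma sgn1 e : sgn e 1%g = 1.
Proof. by rewrite /sgn odd_perm1 andbF. Qed.

Lemma sgn_tperm e (u v : T) : u != v -> sgn e (tperm u v) = (-1) ^+ e.
Proof. by rewrite /sgn odd_tperm andbC => ->. Qed.

Lemma sgn_sqr e s : sgn e s * sgn e s = 1.
Proof. by rewrite /sgn -expr2 sqrr_sign. Qed.

Definition signed_sum e X F : rat := \sum_(s | perm_on X s) sgn e s * F s.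

Lemma eq_signed_sum e X F G :
  (forall s, perm_on X s -> F s = G s) -> signed_sum e X F = signed_sum e X G.
Proof. by move=> FG; apply: eq_bigr => s /FG ->. Qed.

Lemma signed_sumD e X F G : signed_sum e X (fun s => F s + G s) = signed_sum e X F + signed_sum e X G.
Proof. by rewrite -big_split; apply: eq_bigr => s _; rewrite mulrDr. Qed.

Lemma signed_sumZ e X c F : signed_sum e X (fun s => c * F s) = c * signed_sum e X F.
Proof. by rewrite mulr_sumr; apply: eq_bigr => s _; rewrite mulrCA. Qed.

Lemma signed_sum_sum e X (I : finType) (P : pred I) (F : I -> {perm T} -> rat) :
  signed_sum e X (fun s => \sum_(i | P i) F i s) = \sum_(i | P i) signed_sum e X (F i).
Proof.
rewrite exchange_big /=; apply: eq_bigr => s _; exact: mulr_sumr.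
Qed.

Lemma signed_sumC e f X Y (F : {perm T} -> {perm T} -> rat) :
  signed_sum e X (fun s => signed_sum f Y (F s)) = signed_sum f Y (fun t => signed_sum e X (F^~ t)).
Proof.
under [LHS]eq_bigr => s _ do rewrite mulr_sumr.
under [RHS]eq_bigr => s _ do rewrite mulr_sumr.
rewrite exchange_big /=; apply: eq_bigr => t _; apply: eq_bigr => s _.
exact: mulrCA.
Qed.

Lemma signed_sum_shiftl e X h F : perm_on X h ->
  signed_sum e X (fun s => F (h * s)%g) = sgn e h * signed_sum e X F.
Proof.
move=> hX; rewrite mulr_sumr [RHS](reindex_inj (mulgI h)) /=.
rewrite [RHS](eq_bigl (perm_on X)) => [|s]; last first.
  apply/idP/idP => [hsX|]; last exact: perm_onM.
  by rewrite -(mulKg h s) perm_onM // perm_onV.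
by apply: eq_bigr => s _; rewrite sgnM !mulrA (sgn_sqr e h) mul1r.
Qed.

Lemma signed_sum_shiftr e X h F : perm_on X h ->
  signed_sum e X (fun s => F (s * h)%g) = sgn e h * signed_sum e X F.
Proof.
move=> hX; rewrite mulr_sumr [RHS](reindex_inj (mulIg h)) /=.
rewrite [RHS](eq_bigl (perm_on X)) => [|s]; last first.
  apply/idP/idP => [hsX|sX]; last exact: perm_onM.
  by rewrite -(mulgK h s) perm_onM // perm_onV.
by apply: eq_bigr => s _; rewrite sgnM mulrCA -!mulrA (mulrA (sgn e h)) (sgn_sqr e h) mul1r.
Qed.

Lemma signed_sumV e X F : signed_sum e X (fun s => F s^-1%g) = signed_sum e X F.
Proof.
rewrite [RHS](reindex_inj invg_inj) /= [RHS](eq_bigl (perm_on X)) => [|s].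
  by apply: eq_bigr => s _; rewrite sgnV.
by apply/idP/idP => [/perm_onV|]; rewrite ?invgK //; exact: perm_onV.
Qed.

Lemma perm_onJ X s h : perm_on (h @: X) (s ^ h)%g = perm_on X s.
Proof.
apply/subsetP/subsetP => [sP z|sP z]; rewrite unfold_in.
  move=> szN; have := sP (h z); rewrite unfold_in permJ (inj_eq perm_inj).
  by move=> /(_ szN); rewrite mem_imset //; exact: perm_inj.
rewrite -{1 2}(permKV h z) permJ (inj_eq perm_inj) => szN.
by rewrite -(permKV h z) imset_f // sP // unfold_in.
Qed.

Lemma signed_sum_conj e X h F : signed_sum e (h @: X) F = signed_sum e X (fun s => F (s ^ h)%g).
Proof.
rewrite [LHS](reindex_inj (conjg_inj h)) /=.
by apply: eq_big => [s|s _]; rewrite ?perm_onJ ?sgnJ.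
Qed.

Lemma signed_sum_const e X F c : (forall s, perm_on X s -> F s = sgn e s * c) ->
  signed_sum e X F = (#|X|)`!%:R * c.
Proof.
move=> Fc; rewrite /signed_sum (eq_bigr (fun=> c)) => [|s /Fc ->]; last first.
  by rewrite mulrA (sgn_sqr e s) mul1r.
by rewrite sumr_const card_perm mulr_natl.
Qed.

Lemma signed_sum1 e X F (x : T) : X \subset [set x] -> signed_sum e X F = F 1%g.
Proof.
move=> Xx; rewrite /signed_sum (bigD1 1%g) ?perm_on1 //= sgn1 mul1r big1 ?addr0 //.
move=> s /andP[/perm_on_id ->]; rewrite ?eqxx //.
by rewrite (leq_trans (subset_leq_card Xx)) ?cards1.
Qed.

Lemma perm_onS X Y s : X \subset Y -> perm_on X s -> perm_on Y s.
Proof. by move=> XY sX; apply: subset_trans XY. Qed.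

Lemma perm_on_tperm X u v : u \in X -> v \in X -> perm_on X (tperm u v).
Proof.
by move=> uX vX; apply: perm_onS (tperm_on u v); rewrite subUset !sub1set uX.
Qed.

Lemma tperm_comm u v t : t u = u -> t v = v -> (tperm u v * t = t * tperm u v)%g.
Proof. by move=> tu tv; rewrite conjgC tpermJ tu tv. Qed.

(** Coset decomposition: the elements of Sym(v + X) that send [v] to [a] form Sym(X)(v a). The
    transpositions (v a) add up to the Jucys-Murphy element of [v]. *)
Lemma signed_sum_insertr e X v F : v \notin X ->
  signed_sum e (v |: X) F = signed_sum e X F
    + (-1) ^+ e * \sum_(a in X) signed_sum e X (fun s => F (s * tperm v a)%g).
Proof.
move=> vX; rewrite /signed_sum (partition_big (fun s : {perm T} => s v) (mem (v |: X))) /=; last first.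
  by move=> s sP; rewrite perm_closed ?setU11.
rewrite big_setU1 //=; congr (_ + _).
  apply: eq_bigl => s; apply/andP/idP => [[sP /eqP sv]|sP].
    apply/subsetP => z zs; have := subsetP sP _ zs; rewrite in_setU1.
    by case/orP => // /eqP zv; move: zs; rewrite zv unfold_in sv eqxx.
  by rewrite (perm_onS _ sP) ?subsetUr // (out_perm sP).
rewrite mulr_sumr; apply: eq_bigr => a aX.
have av : v != a by apply: contraNneq vX => ->.
rewrite mulr_sumr (reindex_inj (mulIg (tperm v a))) /=.
apply: eq_big => [s|s _]; last by rewrite sgnM sgn_tperm // mulrCA !mulrA.
have tP : perm_on (v |: X) (tperm v a) by rewrite perm_on_tperm ?setU11 // setU1r.
rewrite permM; apply/andP/idP => [[sP /eqP sv]|sP].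
  have {}sv : s v = v by apply/(@perm_inj _ (tperm v a)); rewrite sv tpermL.
  have {}sP : perm_on (v |: X) s.
    by rewrite -(mulgK (tperm v a) s) perm_onM // perm_onV.
  apply/subsetP => z zs; have := subsetP sP _ zs; rewrite in_setU1.
  by case/orP => // /eqP zv; move: zs; rewrite zv unfold_in sv eqxx.
rewrite (out_perm sP) // tpermL eqxx; split=> //.
by rewrite perm_onM // (perm_onS _ sP) ?subsetUr.
Qed.

Lemma signed_sum_insertl e X v F : v \notin X ->
  signed_sum e (v |: X) F = signed_sum e X F
    + (-1) ^+ e * \sum_(a in X) signed_sum e X (fun s => F (tperm v a * s)%g).
Proof.
move=> vX; rewrite -signed_sumV signed_sum_insertr // signed_sumV; congr (_ + _ * _).
apply: eq_bigr => a _; rewrite -signed_sumV; apply: eq_bigr => s _.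
by rewrite invMg invgK tpermV.
Qed.

End SignedSums.

(** * Hook Young symmetrizers *)

Section HookSums.
Variables (T : finType) (x : rat).
Implicit Types (X Y R A B C : {set T}) (s t h r m : {perm T}) (F G : {perm T} -> rat).

Lemma porbitJ s h z : porbit (s ^ h)%g (h z) = h @: porbit s z.
Proof.
apply/setP => y; apply/porbitP/imsetP => [[i ->]|[_ /porbitP[i ->] ->]].
  by exists ((s ^+ i)%g z); rewrite ?mem_porbit // -conjXg permJ.
by exists i; rewrite -conjXg permJ.
Qed.

Lemma card_porbitsJ s h : #|porbits (s ^ h)%g| = #|porbits s|.
Proof.
rewrite -[RHS](card_imset _ (imset_inj (@perm_inj _ h))); congr #|pred_of_set _|.
apply/setP => P; apply/imsetP/imsetP => [[z _ ->]|[Q QP ->]].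
  by exists (porbit s (h^-1%g z)); rewrite ?imset_f // -porbitJ permKV.
by case/imsetP: QP => z _ ->; exists (h z); rewrite ?porbitJ.
Qed.

Lemma card_porbitsC s t : #|porbits (s * t)%g| = #|porbits (t * s)%g|.
Proof. by rewrite -(card_porbitsJ (s * t)%g s) conjgE mulgA mulKg. Qed.

Definition cycw s : rat := x ^+ #|porbits s|.

Lemma cycwJ s h : cycw (s ^ h)%g = cycw s.
Proof. by rewrite /cycw card_porbitsJ. Qed.

Lemma cycwC s t : cycw (s * t)%g = cycw (t * s)%g.
Proof. by rewrite /cycw card_porbitsC. Qed.

Lemma porbit_fix s z : s z = z -> porbit s z = [set z].
Proof.
move=> sz; apply/setP => y; rewrite inE; apply/porbitP/eqP => [[i ->]|->].
  by elim: i => [|i IH]; rewrite ?perm1 // expgSr permM IH.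
by exists 0%N; rewrite perm1.
Qed.

(** Since [v] is fixed by both factors, it is a singleton cycle of [s * t]; inserting (v a) merges
    it with another cycle. The powers of x in later statements count such merges. *)
Lemma card_porbits_join s t v a : s v = v -> t v = v -> a != v ->
  (#|porbits (s * tperm v a * t)%g|).+1 = #|porbits (s * t)%g|.
Proof.
move=> sv tv av.
rewrite -mulgA !(card_porbitsC s) -mulgA.
have := porbits_mul_tperm (t * s)%g v a; rewrite eq_sym av porbit_sym.
rewrite porbit_fix ?permM ?tv // inE av /= addn1 addn2 => -[->].
by [].
Qed.

Lemma cycw_join s t v a : s v = v -> t v = v -> a != v ->
  x * cycw (s * tperm v a * t)%g = cycw (s * t)%g.
Proof. by move=> sv tv av; rewrite /cycw -exprS (card_porbits_join sv tv). Qed.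

(** Each transposition of the coset expansion costs one cycle, so [v] contributes its content, x
    plus or minus the number of points already present. *)
Lemma signed_sum_trace e X v r : v \notin X -> r v = v ->
  x * signed_sum e (v |: X) (fun s => cycw (s * r)%g) =
  (x + (-1) ^+ e * #|X|%:R) * signed_sum e X (fun s => cycw (s * r)%g).
Proof.
move=> vX rv; rewrite signed_sum_insertr // mulrDr mulrDl; congr (_ + _).
rewrite mulrCA -mulrA; congr (_ * _); rewrite mulr_sumr.
rewrite (eq_bigr (fun=> signed_sum e X (fun s => cycw (s * r)%g))) => [|a aX].
  by rewrite sumr_const mulr_natl.
rewrite -signed_sumZ; apply: eq_signed_sum => s sX; apply: cycw_join => //.
  exact: out_perm sX vX.
by apply: contraNneq vX => <-.
Qed.

Lemma signed_sum_trace_all e (c : T) A r : c \notin A -> {in A, forall z, r z = z} ->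
  x ^+ #|A| * signed_sum e (c |: A) (fun s => cycw (s * r)%g) =
  (\prod_(i < #|A|) (x + (-1) ^+ e * i.+1%:R)) * cycw r.
Proof.
elim/set_insert_ind: A => [|v A vA IH] cA rA.
  by rewrite cards0 big_ord0 (@signed_sum1 _ _ _ _ c) ?setU0 ?mul1g.
move: cA; rewrite in_setU1 negb_or => /andP[cv cA].
have vcA : v \notin c |: A by rewrite in_setU1 negb_or eq_sym cv.
rewrite cardsU1 vA big_ord_recr /= exprSr -mulrA setUCA signed_sum_trace //; last first.
  by rewrite rA ?setU11.
rewrite cardsU1 cA mulrCA IH // => [|z zA]; last by rewrite rA ?setU1r.
by rewrite mulrCA mulrA.
Qed.

(* [h = 1] gives the Young symmetrizer; a general [h] records what sits between
   the row group and the column group. *)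
Definition young_sum X Y (h : {perm T}) F : rat :=
  signed_sum false X (fun k => signed_sum true Y (fun t => F (k * h * t)%g)).

Lemma young_sum_absorbl X Y k h F : perm_on X k -> young_sum X Y (k * h)%g F = young_sum X Y h F.
Proof.
move=> kX; rewrite /young_sum -[RHS]mul1r -[1 in RHS](_ : sgn false k = 1) //.
rewrite -signed_sum_shiftr //; apply: eq_signed_sum => s _; apply: eq_signed_sum => t _.
by rewrite !mulgA.
Qed.

Lemma young_sum_absorbr X Y t h F : perm_on Y t ->
  young_sum X Y (h * t)%g F = sgn true t * young_sum X Y h F.
Proof.
move=> tY; rewrite /young_sum -signed_sumZ; apply: eq_signed_sum => s _.
by rewrite -signed_sum_shiftl //; apply: eq_signed_sum => t' _; rewrite !mulgA.
Qed.

(* (c z)(c b) = (c b)(b z), where the first (c z) is absorbed with sign + and the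
   last (b z) with sign -. *)
Lemma young_sum_trans0 X Y (c z b : T) F : c \in X -> z \in X -> z \in Y -> b \in Y ->
  c != b -> c != z -> b != z -> young_sum X Y (tperm c b) F = 0.
Proof.
move=> cX zX zY bY cb cz bz.
have E : young_sum X Y (tperm c b) F = - young_sum X Y (tperm c b) F.
  rewrite -{1}(young_sum_absorbl Y (tperm c b) F (perm_on_tperm cX zX)).
  rewrite conjgC tpermJ tpermL (@tpermD _ c b z) //.
  by rewrite young_sum_absorbr ?perm_on_tperm // sgn_tperm // mulN1r.
lra.
Qed.

Lemma young_sum_insertl X Y h v F : v \notin X ->
  young_sum (v |: X) Y h F = young_sum X Y h F + \sum_(c in X) young_sum X Y (tperm v c * h)%g F.
Proof.
move=> vX; rewrite /young_sum signed_sum_insertr // expr0 mul1r; congr (_ + _).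
apply: eq_bigr => c _; apply: eq_signed_sum => k _; apply: eq_signed_sum => t _.
by rewrite !mulgA.
Qed.

Lemma young_sum_insertr X Y h u F : u \notin Y ->
  young_sum X (u |: Y) h F = young_sum X Y h F - \sum_(b in Y) young_sum X Y (h * tperm u b)%g F.
Proof.
move=> uY; rewrite /young_sum -signed_sum_sum -mulN1r -signed_sumZ -signed_sumD; apply: eq_signed_sum => k _.
rewrite signed_sum_insertl // expr1; congr (_ + _ * _).
by apply: eq_bigr => b _; apply: eq_signed_sum => t _; rewrite !mulgA.
Qed.

Lemma young_sum_tperm X Y h u v r : u \notin Y -> v \notin Y ->
  young_sum X Y h (fun s => cycw (s * (tperm u v * r))%g) =
  young_sum X Y (h * tperm u v)%g (fun s => cycw (s * r)%g).
Proof.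
move=> uY vY; apply: eq_signed_sum => k _; apply: eq_signed_sum => t tY.
by rewrite !mulgA -(mulgA (k * h)%g t) -tperm_comm ?(out_perm tY) // !mulgA.
Qed.

Lemma young_sum_join X Y h1 h2 v a r : v \notin X -> v \notin Y -> r v = v ->
  h1 v = v -> h2 v = v -> a != v ->
  x * young_sum X Y (h1 * tperm v a * h2)%g (fun s => cycw (s * r)%g) =
  young_sum X Y (h1 * h2)%g (fun s => cycw (s * r)%g).
Proof.
move=> vX vY rv h1v h2v av; rewrite -signed_sumZ; apply: eq_signed_sum => k kX.
rewrite -signed_sumZ; apply: eq_signed_sum => t tY.
have := @cycw_join (k * h1) (h2 * t * r) v a; rewrite !mulgA; apply=> //.
  by rewrite permM (out_perm kX).
by rewrite !permM h2v (out_perm tY).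
Qed.

Lemma young_sum_join1 X Y v a r : v \notin X -> v \notin Y -> r v = v -> a != v ->
  x * young_sum X Y (tperm v a) (fun s => cycw (s * r)%g) =
  young_sum X Y 1%g (fun s => cycw (s * r)%g).
Proof.
move=> vX vY rv av; have := @young_sum_join X Y 1 1 v a r vX vY rv (perm1 _) (perm1 _) av.
by rewrite !mulg1 !mul1g.
Qed.

(* Expanding the two groups along [v] and [u] leaves multiples of one and the same
   sum, which cancel, and terms that vanish by [young_sum_trans0]. *)
Lemma young_sum_cross X Y z u v r : x != 0 ->
  z \in X -> z \in Y -> (forall c, c \in X -> c \in Y -> c = z) ->
  u \notin X -> u \notin Y -> v \notin X -> v \notin Y -> u != v ->
  r u = u -> r v = v ->
  young_sum (v |: X) (u |: Y) 1%g (fun s => cycw (s * (tperm u v * r))%g) = 0.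
Proof.
move=> x0 zX zY XY uX uY vX vY uv ru rv.
have uvY : v \notin u |: Y by rewrite in_setU1 negb_or eq_sym uv.
have nX c y : c \in X -> y \notin X -> c != y by move=> cX; apply: contraNneq => <-.
have nY c y : c \in Y -> y \notin Y -> c != y by move=> cX; apply: contraNneq => <-.
set F := fun s => _.
rewrite young_sum_insertl // young_sum_insertr //.
under [X in _ + X = _]eq_bigr => c _ do rewrite young_sum_insertr // mulg1.
under [X in _ - X + _]eq_bigr => b _ do rewrite mul1g.
rewrite /F {F} young_sum_tperm // ?mul1g.
under [X in _ - X + _]eq_bigr => b _ do rewrite young_sum_tperm //.
under [X in _ + X = _]eq_bigr => c _ do rewrite young_sum_tperm //.
have E c : \sum_(b in Y) young_sum X Y (tperm v c * tperm u b)%g (fun s => cycw (s * (tperm u v * r))%g)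
  = \sum_(b in Y) young_sum X Y (tperm v c * tperm u b * tperm u v)%g (fun s => cycw (s * r)%g).
  by apply: eq_bigr => b _; rewrite young_sum_tperm.
under [X in _ + X = _]eq_bigr => c _ do rewrite E.
clear E; set M := fun h => young_sum X Y h (fun s => cycw (s * r)%g).
rewrite -/(M (tperm u v)).
have M1 : x * M (tperm u v) = M 1%g by rewrite /M young_sum_join1 // eq_sym.
have Mc c : c \in X -> x ^+ 2 * M (tperm v c * tperm u v)%g = M 1%g.
  move=> cX; rewrite expr2 -mulrA.
  have := @young_sum_join X Y (tperm v c) 1 u v r uX uY ru; rewrite !mulg1 => -> //.
  - by rewrite young_sum_join1 // nX.
  - by rewrite tpermD // ?(eq_sym v) // nX.
  - by rewrite perm1.
  - by rewrite eq_sym.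
have Mb b : b \in Y -> x ^+ 2 * M (tperm u b * tperm u v)%g = M 1%g.
  move=> bY; rewrite expr2 -mulrA (tpermC u v).
  have := @young_sum_join X Y (tperm u b) 1 v u r vX vY rv; rewrite !mulg1 => -> //.
  - by rewrite young_sum_join1 // nY.
  - by rewrite tpermD // nY.
  - by rewrite perm1.
(* For c = b = z the three transpositions collapse to (u z): one merge instead of two, hence x in
   place of x^2. *)
have Mzz : x * M (tperm v z * tperm u z * tperm u v)%g = M 1%g.
  have -> : (tperm v z * tperm u z * tperm u v = tperm u z)%g.
    rewrite (conjgC (tperm v z)) tpermJ tpermR (@tpermD _ u z v) // ?(nX z) //.
    by rewrite (tpermC v u) -mulgA tperm2 mulg1.
  by rewrite /M young_sum_join1 // nX.
have Mcb c b : c \in X -> b \in Y -> c != b ->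
    x ^+ 2 * M (tperm v c * tperm u b * tperm u v)%g = M (tperm c b).
  move=> cX bY cb.
  (* In this form [v] occurs in the last factor only and, once that is stripped, so does [u]; two
     merges then leave (c b). *)
  have -> : (tperm v c * tperm u b * tperm u v = tperm c b * tperm u b * tperm v c)%g.
    have E1 : (tperm u b * tperm v c = tperm v c * tperm u b)%g.
      rewrite tperm_comm // tpermD //; first by rewrite eq_sym.
      - exact: nX.
      - by rewrite eq_sym nY.
    have E2 : (tperm c b * tperm v c = tperm v c * tperm v b)%g.
      rewrite (conjgC (tperm c b)) tpermJ tpermR (@tpermD _ v c b) //.
      by rewrite eq_sym nY.
    have E3 : (tperm v b * tperm u b = tperm u b * tperm u v)%g.
      rewrite (conjgC (tperm v b)) tpermJ tpermR (@tpermD _ u b v) ?(tpermC v u) //.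
      by rewrite nY.
    by rewrite -[in RHS]mulgA E1 mulgA E2 -!mulgA E3.
  rewrite expr2 -mulrA.
  have := @young_sum_join X Y (tperm c b * tperm u b) 1 v c r vX vY rv; rewrite !mulg1 => -> //.
  - have := @young_sum_join X Y (tperm c b) 1 u b r uX uY ru; rewrite !mulg1 => -> //.
    + by rewrite tpermD ?(nX c) ?(nY b).
    + by rewrite perm1.
    + by rewrite nY.
  - by rewrite permM (@tpermD _ c b) ?(@tpermD _ u b) ?(nX c) ?(nY b).
  - by rewrite perm1.
  - by rewrite nX.
have Mzb b : b \in Y -> b != z -> M (tperm z b) = - M 1%g.
  move=> bY bz; rewrite -[tperm z b]mul1g /M young_sum_absorbr ?perm_on_tperm //.
  by rewrite sgn_tperm 1?eq_sym // mulN1r.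
have Mcz c : c \in X -> M (tperm c z) = M 1%g.
  by move=> cX; rewrite -[tperm c z]mulg1 /M young_sum_absorbl ?perm_on_tperm.
have Mcb0 c b : c \in X -> c != z -> b \in Y -> b != z -> M (tperm c b) = 0.
  move=> cX cz bY bz; apply: (@young_sum_trans0 X Y c z b) => //.
  by apply: contraNneq cz => cb; apply/eqP/XY => //; rewrite cb.
have SB : x ^+ 2 * \sum_(b in Y) M (tperm u b * tperm u v)%g = #|Y|%:R * M 1%g.
  by rewrite mulr_sumr (eq_bigr _ Mb) sumr_const mulr_natl.
have SC : x ^+ 2 * \sum_(c in X) M (tperm v c * tperm u v)%g = #|X|%:R * M 1%g.
  by rewrite mulr_sumr (eq_bigr _ Mc) sumr_const mulr_natl.
have cardD (Z : {set T}) : z \in Z -> #|Z|%:R = 1 + #|Z :\ z|%:R :> rat.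
  by move=> zZ; rewrite (cardsD1 z) zZ natrD.
have sum_const (Z : {set T}) (a : rat) : \sum_(i in Z | i != z) a = #|Z :\ z|%:R * a.
  rewrite sumr_const mulr_natl; congr (_ *+ _); apply: eq_card => y.
  by rewrite !inE andbC.
have SCB : x ^+ 2 * \sum_(c in X) \sum_(b in Y) M (tperm v c * tperm u b * tperm u v)%g
   = x * M 1%g - #|Y :\ z|%:R * M 1%g + #|X :\ z|%:R * M 1%g.
  rewrite (bigD1 z) //= (bigD1 z zY) /= 2!mulrDr; congr (_ + _ + _).
  - by rewrite expr2 -mulrA Mzz.
  - rewrite mulr_sumr -mulrN -sum_const; apply: eq_bigr => b /andP[bY bz].
    by rewrite Mcb ?Mzb // eq_sym.
  - rewrite mulr_sumr -sum_const; apply: eq_bigr => c /andP[cX cz].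
    rewrite (bigD1 z) //= mulrDr Mcb // Mcz // mulr_sumr big1 ?addr0 // => b /andP[bY bz].
    rewrite Mcb ?Mcb0 //.
    by apply: contraNneq cz => cb; apply/eqP/XY => //; rewrite cb.
(* The multiples of [M 1] add up to x - |Y| + |X| - (x - (|Y|-1) + (|X|-1)) = 0. *)
apply: (mulfI (expf_neq0 2 x0)); rewrite mulr0 sumrB mulrDr !mulrBr.
rewrite SB SC SCB !(cardD X) // !(cardD Y) // expr2 -mulrA M1; ring.
Qed.

Lemma young_sum_tracel X Y v r : v \notin X -> v \notin Y -> r v = v ->
  x * young_sum (v |: X) Y 1%g (fun s => cycw (s * r)%g) =
  (x + #|X|%:R) * young_sum X Y 1%g (fun s => cycw (s * r)%g).
Proof.
move=> vX vY rv; rewrite /young_sum [in LHS]signed_sumC [in RHS]signed_sumC -!signed_sumZ.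
apply: eq_signed_sum => t tY.
have E Z : signed_sum false Z (fun k => cycw (k * 1 * t * r)%g) = signed_sum false Z (fun k => cycw (k * (t * r))%g).
  by apply: eq_signed_sum => k _; rewrite mulg1 mulgA.
by rewrite !E signed_sum_trace ?expr0 ?mul1r // permM (out_perm tY).
Qed.

Lemma young_sum_tracer X Y v r : v \notin X -> v \notin Y -> r v = v ->
  x * young_sum X (v |: Y) 1%g (fun s => cycw (s * r)%g) =
  (x - #|Y|%:R) * young_sum X Y 1%g (fun s => cycw (s * r)%g).
Proof.
move=> vX vY rv; rewrite /young_sum -!signed_sumZ; apply: eq_signed_sum => k kX.
have E Z : signed_sum true Z (fun t => cycw (k * 1 * t * r)%g) = signed_sum true Z (fun t => cycw (t * (r * k))%g).
  by apply: eq_signed_sum => t _; rewrite mulg1 -(mulgA k) [LHS]cycwC -mulgA.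
by rewrite !E signed_sum_trace ?expr1 ?mulN1r // permM rv (out_perm kX).
Qed.

End HookSums.

(** * Deleting a non-mixed pair from the hook symmetrizers of a row *)

Section PairRemoval.
Variables (T : finType) (x : rat).
Implicit Types (X Y R A B C : {set T}) (s t h r m : {perm T}) (F G : {perm T} -> rat).
Implicit Types (z u v : T) (g : nat -> rat).

Lemma setU1Dl v A B : v \notin B -> (v |: A) :\: B = v |: (A :\: B).
Proof.
move=> vB; apply/setP => y; rewrite !inE.
by case: (y =P v) => [->|]; rewrite ?vB ?andbF.
Qed.

Lemma setU1Dlr v A B : v \notin A -> (v |: A) :\: (v |: B) = A :\: B.
Proof.
move=> vA; apply/setP => y; rewrite !inE.
by case: (y =P v) => [->|]; rewrite ?(negbTE vA) ?andbF.
Qed.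

(** Arm [A :\: B], leg [B], corner [z] in both groups. The weight is a general function of the leg
    length because deleting pairs turns the initial signs into polynomials in x. *)
Definition hook_comb z A g h F : rat :=
  \sum_(B : {set T} | B \subset A)
     g #|B| * young_sum (z |: (A :\: B)) (z |: B) h F.

Lemma hook_combU1 z v A g h F : v \notin z |: A ->
  hook_comb z (v |: A) g h F =
  \sum_(B : {set T} | B \subset A)
     (g #|B| * young_sum (v |: (z |: (A :\: B))) (z |: B) h F
      + g #|B|.+1 * young_sum (z |: (A :\: B)) (v |: (z |: B)) h F).
Proof.
rewrite in_setU1 negb_or => /andP[vz vA]; rewrite /hook_comb big_subsetU1 //.
apply: eq_bigr => B sB.
have vB : v \notin B by apply: contra vA => /(subsetP sB).
by rewrite setU1Dl // setU1Dlr // cardsU1 vB setUCA [z |: (v |: B)]setUCA.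
Qed.

(* [n - b] is meant for [b <= n]: it is the arm length of the hook that is left. *)
Definition pair_step (n : nat) g (b : nat) : rat :=
  g b * ((x + (n - b).+1%:R) * (x + (n - b).+2%:R))
  - g b.+2 * ((x - b.+1%:R) * (x - b.+2%:R)).

(** Subsets are sorted by which of [u], [v] lie in the leg. With one in each group the term vanishes
    by [young_sum_cross]. With both in one group, that group absorbs (u v), with sign + for the arm
    and - for the leg, and tracing out [u] and [v] yields two consecutive contents. *)
Lemma hook_comb_step z A g u v r : x != 0 -> z \notin A ->
  u \notin z |: A -> v \notin z |: A -> u != v -> r u = u -> r v = v ->
  x ^+ 2 * hook_comb z (u |: (v |: A)) g 1%g (fun s => cycw x (s * (tperm u v * r))%g) =
  hook_comb z A (pair_step #|A| g) 1%g (fun s => cycw x (s * r)%g).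
Proof.
move=> x0 zA uzA vzA uv ru rv.
have := uzA; rewrite in_setU1 negb_or => /andP[uz uA].
have := vzA; rewrite in_setU1 negb_or => /andP[vz vA].
rewrite /hook_comb big_subsetU1; last by rewrite in_setU1 negb_or uv.
rewrite big_subsetU1 // mulr_sumr; apply: eq_bigr => B sB.
have uB : u \notin B by apply: contra uA => /(subsetP sB).
have vB : v \notin B by apply: contra vA => /(subsetP sB).
have zB : z \notin B by apply: contra zA => /(subsetP sB).
have uvB : u \notin v |: B by rewrite in_setU1 negb_or uv.
have uvA : u \notin v |: A by rewrite in_setU1 negb_or uv.
rewrite (setU1Dl _ uB) (setU1Dl _ vB) (setU1Dl _ uvB) (setU1Dlr _ vA).
rewrite !(setU1Dlr _ uvA) (setU1Dl _ vB) (setU1Dlr _ vA).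
rewrite !cardsU1 uvB uB vB /=.
set X := z |: (A :\: B); set Y := z |: B.
have uX : u \notin X by rewrite !inE negb_or uz negb_and uA orbT.
have vX : v \notin X by rewrite !inE negb_or vz negb_and vA orbT.
have uY : u \notin Y by rewrite !inE negb_or uz uB.
have vY : v \notin Y by rewrite !inE negb_or vz vB.
have zX : z \in X by rewrite setU11.
have zY : z \in Y by rewrite setU11.
have XY c : c \in X -> c \in Y -> c = z.
  by rewrite !inE => /orP[/eqP//|/andP[/negbTE -> _]]; rewrite orbF => /eqP.
have cX : #|X| = (#|A| - #|B|).+1.
  by rewrite cardsU1 !inE (negbTE zA) andbF cardsD (setIidPr sB).
have cY : #|Y| = #|B|.+1 by rewrite cardsU1 zB.
rewrite !(setUCA [set z]) -/X -/Y.
have -> : young_sum (v |: X) (u |: Y) 1%g (fun s => cycw x (s * (tperm u v * r))%g) = 0.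
  exact: (@young_sum_cross _ _ X Y z).
have -> : young_sum (u |: X) (v |: Y) 1%g (fun s => cycw x (s * (tperm u v * r))%g) = 0.
  by rewrite tpermC; apply: (@young_sum_cross _ _ X Y z) => //; rewrite eq_sym.
have uvX : u \notin v |: X by rewrite in_setU1 negb_or uv.
have uvY : u \notin v |: Y by rewrite in_setU1 negb_or uv.
have CC : x ^+ 2 * young_sum (u |: (v |: X)) Y 1%g (fun s => cycw x (s * (tperm u v * r))%g) =
    (x + (#|A| - #|B|).+1%:R) * (x + (#|A| - #|B|).+2%:R) *
    young_sum X Y 1%g (fun s => cycw x (s * r)%g).
  rewrite young_sum_tperm // mul1g -[tperm u v]mulg1 young_sum_absorbl; last first.
    by rewrite perm_on_tperm ?setU11 // !inE eqxx orbT.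
  rewrite expr2 -mulrA young_sum_tracel // mulrCA young_sum_tracel // mulrA cardsU1 vX cX /=.
  by rewrite mulrC [in LHS](mulrC (x + _)) mulrC.
have BB : x ^+ 2 * young_sum X (u |: (v |: Y)) 1%g (fun s => cycw x (s * (tperm u v * r))%g) =
    - ((x - #|B|.+1%:R) * (x - #|B|.+2%:R)) *
    young_sum X Y 1%g (fun s => cycw x (s * r)%g).
  have -> : young_sum X (u |: (v |: Y)) 1%g (fun s => cycw x (s * (tperm u v * r))%g) =
      - young_sum X (u |: (v |: Y)) 1%g (fun s => cycw x (s * r)%g).
    rewrite -mulN1r -signed_sumZ; apply: eq_signed_sum => k _.
    have uvP : perm_on (u |: (v |: Y)) (tperm u v).
      by rewrite perm_on_tperm ?setU11 // !inE eqxx orbT.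
    have := signed_sum_shiftr true (fun t => cycw x (k * 1 * t * r)%g) uvP.
    rewrite sgn_tperm // expr1 => <-; apply: eq_signed_sum => t _.
    by rewrite !mulgA.
  rewrite mulrN expr2 -mulrA young_sum_tracer // mulrCA young_sum_tracer // mulrA cardsU1 vY cY /=.
  by rewrite mulNr; congr (- (_ * _)); rewrite mulrC.
rewrite !mulr0 addr0 add0r mulrDr !(mulrCA (x ^+ 2)).
rewrite CC BB /pair_step; ring.
Qed.
End PairRemoval.

(** * Sums over cycles *)

Section Cycles.
Variables (T : finType).
Implicit Types (X Y R A B C : {set T}) (s t h r m : {perm T}) (F G : {perm T} -> rat).
Implicit Types (z u v : T) (g : nat -> rat).

Lemma card_porbits_on R s : perm_on R s ->
  (#|porbits s| + #|R| = #|T| + #|porbit s @: R|)%N.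
Proof.
move=> sR; have fixC z : z \notin R -> porbit s z = [set z].
  by move=> zR; rewrite porbit_fix // (out_perm sR).
have -> : porbits s = porbit s @: R :|: porbit s @: (~: R).
  rewrite -imsetU setUCr; apply/setP => P.
  by apply/imsetP/imsetP => -[z _ ->]; exists z.
have -> : (#|porbit s @: R :|: porbit s @: (~: R)| = #|porbit s @: R| + #|~: R|)%N.
  rewrite cardsU (_ : _ :&: _ = set0).
    rewrite cards0 subn0; congr (_ + _)%N; apply: card_in_imset => y z.
    rewrite !inE => yR zR; rewrite !fixC // => /setP/(_ y).
    by rewrite !inE eqxx => /esym/eqP.
  apply/setP => P; rewrite !inE; apply/negP => /andP[/imsetP[y yR ->]].
  case/imsetP => z; rewrite inE => zR; rewrite (fixC z) // => /setP/(_ y).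
  by rewrite porbit_id inE => /esym/eqP yz; rewrite -yz yR in zR.
by rewrite -addnA (addnC #|~: R|) cardsC addnC.
Qed.

(* Counting orbits makes the condition easy to follow under multiplication by a
   transposition; [cyclic_onP] gives the usual description. *)
Definition cyclic_on R s :=
  perm_on R s && (#|porbits s| + #|R| == #|T|.+1)%N.

Lemma cyclic_onP R s z : z \in R ->
  reflect (perm_on R s /\ porbit s z = R) (cyclic_on R s).
Proof.
move=> zR; apply: (iffP andP) => -[sR]; rewrite card_porbits_on // -addn1 eqn_add2l.
  move=> /cards1P[P EP]; split=> //; apply/setP => y; apply/idP/idP => [|yR].
    by case/porbitP => i ->; elim: i => [|i IH]; rewrite ?perm1 // expgSr permM perm_closed.
  have := imset_f (porbit s) yR; have := imset_f (porbit s) zR.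
  by rewrite EP !inE => /eqP -> /eqP <-; rewrite porbit_id.
move=> zR'; split=> //; apply/cards1P; exists R; apply/setP => P; rewrite inE.
apply/imsetP/eqP => [[y yR ->]|->]; last by exists z.
by rewrite -[RHS]zR'; apply/eqP; rewrite eq_porbit_mem zR'.
Qed.

Definition cycle_sum R F : rat := \sum_(s | cyclic_on R s) F s.

Lemma cycle_sum1 z F : cycle_sum [set z] F = F 1%g.
Proof.
rewrite /cycle_sum (big_pred1 1%g) // => s; rewrite /cyclic_on.
apply/andP/eqP => [[sz _]|->]; first by apply: perm_on_id sz _; rewrite cards1.
rewrite perm_on1 card_porbits_on ?perm_on1 //; split => //.
by rewrite imset_set1 cards1 addn1.
Qed.

Lemma cyclic_on_insert R s v a : v \notin R -> a \in R -> perm_on R s ->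
  cyclic_on (v |: R) (s * tperm v a)%g = cyclic_on R s.
Proof.
move=> vR aR sR; rewrite /cyclic_on sR cardsU1 vR add1n addnS -addSn.
have av : a != v by apply: contraNneq vR => <-.
have := card_porbits_join (out_perm sR vR) (perm1 v) av; rewrite !mulg1 => ->.
by rewrite perm_onM ?perm_on_tperm ?setU11 ?setU1r // (perm_onS _ sR) ?subsetUr.
Qed.

Lemma perm_on_fix R s v : perm_on (v |: R) s -> s v = v -> perm_on R s.
Proof.
move=> sP sv; apply/subsetP => y ys; have := subsetP sP _ ys; rewrite in_setU1.
by case/orP => // /eqP yv; move: ys; rewrite yv unfold_in sv eqxx.
Qed.

Lemma cyclic_on_fixN R s v : v \notin R -> R != set0 ->
  cyclic_on (v |: R) s -> s v \in R.
Proof.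
move=> vR /set0Pn[z zR] /andP[sP]; apply: contraTT => svR.
have sv : s v = v.
  have := perm_closed v sP; rewrite setU11 in_setU1 (negbTE svR) orbF.
  by move=> /eqP.
rewrite cardsU1 vR add1n addnS card_porbits_on ?(perm_on_fix sP) // eqSS.
by rewrite -{2}(addn0 #|T|) eqn_add2l cards_eq0; apply/set0Pn; exists (porbit s z); exact: imset_f.
Qed.

Lemma cyclic_on_delete R s v : v \notin R -> R != set0 -> cyclic_on (v |: R) s ->
  cyclic_on R (s * tperm v (s v))%g.
Proof.
move=> vR R0 sC; have svR := cyclic_on_fixN vR R0 sC.
have sP : perm_on R (s * tperm v (s v))%g.
  apply: (@perm_on_fix _ _ v); last by rewrite permM tpermR.
  by rewrite perm_onM ?perm_on_tperm ?setU11 ?setU1r //; case/andP: sC.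
by rewrite -(cyclic_on_insert vR svR sP) -mulgA tperm2 mulg1.
Qed.

(** A full cycle of v + R arises exactly once by inserting [v] into a full cycle of [R], just before
    its image [a]. *)
Lemma cycle_sum_insert R v F : v \notin R -> R != set0 ->
  cycle_sum (v |: R) F = cycle_sum R (fun s => \sum_(a in R) F (s * tperm v a)%g).
Proof.
move=> vR R0; rewrite /cycle_sum exchange_big /=.
rewrite (partition_big (fun s : {perm T} => s v) (mem R)) /=; last first.
  by move=> s; exact: cyclic_on_fixN.
apply: eq_bigr => a aR; rewrite (reindex_inj (mulIg (tperm v a))) /=.
apply: eq_bigl => s; apply/andP/idP => [[sC /eqP sv]|sC].
  by have := cyclic_on_delete vR R0 sC; rewrite sv -mulgA tperm2 mulg1.
have /andP[sR _] := sC.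
by rewrite cyclic_on_insert // permM (out_perm sR) // tpermL eqxx.
Qed.

Lemma cycle_sum_const R c : R != set0 -> cycle_sum R (fun=> c) = (#|R|.-1)`!%:R * c.
Proof.
case/set0Pn => z zR; rewrite -(setD1K zR); move: (R :\ z) => A.
elim/set_insert_ind: A => [|v A vA IH].
  by rewrite setU0 cycle_sum1 cards1 mul1r.
have [->|vz] := eqVneq v z; first by rewrite setUA setUid.
have vR : v \notin z |: A by rewrite in_setU1 negb_or vz.
rewrite setUCA cycle_sum_insert //; last by apply/set0Pn; exists z; rewrite setU11.
have -> : cycle_sum (z |: A) (fun=> \sum_(a in z |: A) c) = cycle_sum (z |: A) (fun=> c) * #|z |: A|%:R.
  by rewrite mulr_suml; apply: eq_bigr => s _; rewrite sumr_const mulr_natr.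
rewrite IH (cardsU1 v) vR /=.
have : (0 < #|z |: A|)%N by apply/card_gt0P; exists z; rewrite setU11.
by case: #|z |: A| => // n _; rewrite factS natrM /=; ring.
Qed.

(** Induction by deleting [v] from both cycles. A conjugator of the shortened cycles may be preceded
    by any power of the first one; this freedom aligns the successors [a] and [b] of [v], so that (v
    a) goes to (v b). *)
Lemma cyclic_on_conj R s t : R != set0 -> cyclic_on R s -> cyclic_on R t ->
  exists2 h, perm_on R h & t = (s ^ h)%g.
Proof.
case/set0Pn => z zR; rewrite -(setD1K zR); move: (R :\ z) => A.
elim/set_insert_ind: A s t => [|v A vA IH] s t.
  have P1 (s' : {perm T}) : cyclic_on (z |: set0) s' -> s' = 1%g.
    by case/andP => + _; rewrite setU0 => sz; apply: perm_on_id sz _; rewrite cards1.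
  by move=> /P1 -> /P1 ->; exists 1%g; rewrite ?perm_on1 // conjg1.
have [->|vz] := eqVneq v z; first by rewrite setUA setUid; exact: IH.
have vR : v \notin z |: A by rewrite in_setU1 negb_or vz.
have R0 : z |: A != set0 by apply/set0Pn; exists z; rewrite setU11.
rewrite setUCA => sC tC.
have aR := cyclic_on_fixN vR R0 sC; have bR := cyclic_on_fixN vR R0 tC.
have s'C := cyclic_on_delete vR R0 sC; have t'C := cyclic_on_delete vR R0 tC.
set a := s v in aR s'C; set b := t v in bR t'C.
set s' := (s * _)%g in s'C; set t' := (t * _)%g in t'C.
have Es : s = (s' * tperm v a)%g by rewrite -mulgA tperm2 mulg1.
have Et : t = (t' * tperm v b)%g by rewrite -mulgA tperm2 mulg1.
have [h hR Eh] := IH _ _ s'C t'C.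
have [s'R E'] := cyclic_onP s' aR s'C.
have bR' : (h^-1 b)%g \in porbit s' a by rewrite E' perm_closed // perm_onV.
case/porbitP: bR' => i Ei.
have iR : perm_on (z |: A) (s' ^+ i)%g.
  by elim: i {Ei} => [|i IHi]; rewrite ?expg0 ?perm_on1 // expgS perm_onM.
exists (s' ^+ i * h)%g.
  by apply: (perm_onS (subsetUr _ _)); rewrite perm_onM.
rewrite Et Es conjMg; congr (_ * _)%g.
  rewrite conjgM (_ : (s' ^ (s' ^+ i))%g = s') //.
  by apply/conjg_fixP/commgP; exact/commuteX.
by rewrite tpermJ !permM -Ei permKV (out_perm iR) ?(out_perm hR).
Qed.

Lemma cycle_sum_invariant R F s : R != set0 -> cyclic_on R s ->
  (forall t h, perm_on R h -> F (t ^ h)%g = F t) ->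
  cycle_sum R F = (#|R|.-1)`!%:R * F s.
Proof.
move=> R0 sC FJ; rewrite -cycle_sum_const //; apply: eq_bigr => t tC.
by have [h hR ->] := cyclic_on_conj R0 sC tC; rewrite FJ.
Qed.

End Cycles.

(** * Cycle sums as alternating sums of hooks *)

Section CycleSum.
Variables (T : finType).
Implicit Types (X Y R A B C : {set T}) (s t h r m : {perm T}) (F G : {perm T} -> rat).
Implicit Types (z u v : T) (g : nat -> rat).

(** The column group permutes [U] and fixes [v], so it commutes with the sum of the transpositions
    (v a) over [U]. *)
Lemma young_sum_sum X Y (U : {set T}) h v F : Y \subset U -> v \notin Y ->
  \sum_(a in U) young_sum X Y (h * tperm v a)%g F =
  young_sum X Y h (fun s => \sum_(a in U) F (s * tperm v a)%g).
Proof.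
move=> YU vY; rewrite -signed_sum_sum; apply: eq_signed_sum => k _.
rewrite -signed_sum_sum; apply: eq_signed_sum => t tY /=.
rewrite [RHS](reindex_inj (@perm_inj _ t)) /=.
apply: eq_big => [a|a _]; first by rewrite (perm_closed _ (perm_onS YU tY)).
rewrite -[in tperm v (t a)](out_perm tY vY) -tpermJ -!mulgA -conjgC.
by rewrite !mulgA.
Qed.

Definition altsgn (b : nat) : rat := (-1) ^+ b.

(** The terms in which [v] stays fixed occur once with [v] in the arm and once with [v] in the leg,
    with opposite signs, and cancel. On the leg transpositions the two minus signs multiply to +. *)
Lemma hook_comb_altU1 z v A h F : z \notin A -> v \notin z |: A ->
  hook_comb z (v |: A) altsgn h F =
  \sum_(B : {set T} | B \subset A) altsgn #|B| *
    (\sum_(c in z |: (A :\: B)) young_sum (z |: (A :\: B)) (z |: B) (tperm v c * h)%g F +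
     \sum_(b in z |: B) young_sum (z |: (A :\: B)) (z |: B) (h * tperm v b)%g F).
Proof.
move=> zA vzA; rewrite hook_combU1 //; apply: eq_bigr => B sB.
have vX C : C \subset A -> v \notin z |: C.
  by move=> CA; apply: contra vzA; apply: (subsetP (setUS _ CA)).
rewrite young_sum_insertl ?vX ?subsetDl // (@young_sum_insertr _ _ _ _ v) ?vX //.
rewrite /altsgn exprS; ring.
Qed.

Lemma sum_setDU A B (f : T -> rat) : B \subset A ->
  \sum_(a in A :\: B) f a + \sum_(b in B) f b = \sum_(a in A) f a.
Proof.
by move=> BA; rewrite [RHS](big_setID B) /= (setIidPr BA) addrC.
Qed.

Lemma hook_comb_set0 z g h F : hook_comb z set0 g h F = g 0%N * F h.
Proof.
rewrite /hook_comb (big_pred1 set0) => [|B]; last by rewrite subset0.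
by rewrite cards0 setDv setU0 /young_sum (@signed_sum1 _ _ _ _ z) // (@signed_sum1 _ _ _ _ z) // mulg1 mul1g.
Qed.

(* Both sides obey the same recursion: adding a point [v] multiplies them by the
   Jucys-Murphy element of [v]. *)
Lemma hook_comb_tperm z u A F : z \notin A -> u \notin z |: A ->
  hook_comb z A altsgn (tperm u z) F = cycle_sum (u |: (z |: A)) F.
Proof.
elim/set_insert_ind: A F => [|v A vA IH] F zA uA.
  rewrite hook_comb_set0 mul1r setU0 in uA *.
  rewrite cycle_sum_insert //; last by apply/set0Pn; exists z; rewrite inE.
  by rewrite cycle_sum1 big_set1 mul1g.
move: zA uA; rewrite !in_setU1 !negb_or => /andP[zv zA] /and3P[uz uv uA].
have vzA : v \notin z |: A by rewrite in_setU1 negb_or eq_sym zv.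
have uzA : u \notin z |: A by rewrite in_setU1 negb_or uz.
have vuzA : v \notin u |: (z |: A) by rewrite in_setU1 negb_or eq_sym uv.
rewrite [z |: (v |: A)]setUCA setUCA cycle_sum_insert //; last first.
  by apply/set0Pn; exists u; rewrite setU11.
rewrite -IH // hook_comb_altU1 //; apply: eq_bigr => B BA; congr (_ * _).
have zB : z \notin B by apply: contra zA; apply/subsetP.
have vzB : v \notin z |: B by apply: contra vzA; apply: (subsetP (setUS _ BA)).
have uzB : u \notin z |: B by apply: contra uzA; apply: (subsetP (setUS _ BA)).
rewrite -young_sum_sum //; last by rewrite subsetU // setUS ?orbT.
rewrite (big_setU1 _ uzA) /=.
rewrite !big_setU1 ?inE ?(negbTE zA) ?andbF //=.
rewrite -(sum_setDU _ BA).
(* The arm term for c = z supplies a = u, the one transposition that leaves the hook. *)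
have -> : (tperm v z * tperm u z = tperm u z * tperm v u)%g.
  by rewrite (conjgC (tperm v z)) tpermJ tpermR tpermD // eq_sym.
have -> : \sum_(c in A :\: B) young_sum (z |: A :\: B) (z |: B) (tperm v c * tperm u z)%g F
   = \sum_(c in A :\: B) young_sum (z |: A :\: B) (z |: B) (tperm u z * tperm v c)%g F.
  apply: eq_bigr => c; rewrite inE => /andP[_ cA]; rewrite tperm_comm // tpermD //.
  - by apply: contraNneq uA => ->.
  - by apply: contraNneq zA => ->.
by ring.
Qed.

(* The root lies in both groups, so adding [v] gives one more (v z) than the
   Jucys-Murphy element; this is the sum of [hook_comb_tperm]. *)
Lemma hook_comb_cycles z A F : z \notin A ->
  hook_comb z A altsgn 1%g F = #|z |: A|%:R * cycle_sum (z |: A) F.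
Proof.
elim/set_insert_ind: A F => [|v A vA IH] F zA.
  by rewrite hook_comb_set0 setU0 cards1 cycle_sum1.
move: zA; rewrite !in_setU1 !negb_or => /andP[zv zA].
have vzA : v \notin z |: A by rewrite in_setU1 negb_or eq_sym zv.
have R0 : z |: A != set0 by apply/set0Pn; exists z; rewrite setU11.
rewrite setUCA cardsU1 vzA natrD mulrDl mul1r -{1}hook_comb_tperm // cycle_sum_insert // -IH //.
rewrite hook_comb_altU1 // -big_split; apply: eq_bigr => B BA /=; rewrite -mulrDr; congr (_ * _).
have zB : z \notin B by apply: contra zA; apply/subsetP.
have vzB : v \notin z |: B by apply: contra vzA; apply: (subsetP (setUS _ BA)).
rewrite -young_sum_sum //; last by rewrite setUS.
rewrite !big_setU1 ?inE ?(negbTE zA) ?andbF //=.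
rewrite -(sum_setDU _ BA) !mul1g !mulg1.
have E1 (C : {set T}) : \sum_(c in C) young_sum (z |: A :\: B) (z |: B) (tperm v c * 1)%g F
   = \sum_(c in C) young_sum (z |: A :\: B) (z |: B) (tperm v c) F.
  by apply: eq_bigr => c _; rewrite mulg1.
have E2 (C : {set T}) : \sum_(c in C) young_sum (z |: A :\: B) (z |: B) (1 * tperm v c)%g F
   = \sum_(c in C) young_sum (z |: A :\: B) (z |: B) (tperm v c) F.
  by apply: eq_bigr => c _; rewrite mul1g.
rewrite ?E1 ?E2; ring.
Qed.
End CycleSum.

(** * Products of two hook symmetrizers on the same row *)

Section Mixed.
Variables (T : finType) (x : rat).
Implicit Types (X Y U V S R A B C : {set T}) (s t h r m k : {perm T}) (F G : {perm T} -> rat).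
Implicit Types (z u v : T) (g : nat -> rat).

Lemma eq_young_sum X Y h F G : F =1 G -> young_sum X Y h F = young_sum X Y h G.
Proof. by move=> FG; apply: eq_signed_sum => k _; apply: eq_signed_sum => t _. Qed.

Lemma young_sumZ X Y h c F : young_sum X Y h (fun s => c * F s) = c * young_sum X Y h F.
Proof.
by rewrite -signed_sumZ; apply: eq_signed_sum => k _; rewrite -signed_sumZ.
Qed.

Lemma young_sum_bigsum X Y h (I : finType) (P : pred I) (F : I -> {perm T} -> rat) :
  young_sum X Y h (fun s => \sum_(i | P i) F i s) = \sum_(i | P i) young_sum X Y h (F i).
Proof.
by rewrite -signed_sum_sum; apply: eq_signed_sum => k _; rewrite -signed_sum_sum.
Qed.

Lemma young_sumC X Y h X' Y' h' (F : {perm T} -> {perm T} -> rat) :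
  young_sum X Y h (fun s => young_sum X' Y' h' (F s)) = young_sum X' Y' h' (fun t => young_sum X Y h (F^~ t)).
Proof.
rewrite /young_sum.
under eq_signed_sum => k _ do rewrite signed_sumC.
rewrite signed_sumC; apply: eq_signed_sum => k' _.
under eq_signed_sum => k _ do rewrite signed_sumC.
by rewrite signed_sumC.
Qed.

Lemma perm_on_comm A B s t : [disjoint A & B] -> perm_on A s -> perm_on B t ->
  (s * t = t * s)%g.
Proof.
move=> AB sA tB; apply/permP => y; rewrite !permM.
have [yA|yA] := boolP (y \in A).
  by rewrite !(out_perm tB) // (disjointFr AB) // perm_closed.
rewrite (out_perm sA yA).
have [yB|yB] := boolP (y \in B); last by rewrite (out_perm tB) // (out_perm sA).
by rewrite (out_perm sA) // (disjointFl AB) // perm_closed.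
Qed.

(** The constant is the product of the hook lengths. In row-column-row-column, the second row group
    is expanded along cosets of Sym(C), which commutes with the column group: the trivial coset
    gives (|B|+1)!, each of the |C| others gives |B|!, and |C|! factors out. *)
Lemma young_sum_sqr z B C F : z \notin B -> z \notin C -> [disjoint B & C] ->
  young_sum (z |: C) (z |: B) 1%g (fun s => young_sum (z |: C) (z |: B) 1%g (fun t => F (s * t)%g)) =
  (#|C|`! * #|B|`! * (#|B| + #|C|).+1)%:R * young_sum (z |: C) (z |: B) 1%g F.
Proof.
move=> zB zC BC; set X := z |: C; set Y := z |: B.
pose M h := young_sum X Y h F.
pose N h := signed_sum false X (fun k => signed_sum true Y (fun t => signed_sum true Y (fun t' =>
              F (k * t * h * t')%g))).
have NE : young_sum X Y 1%g (fun s => young_sum X Y 1%g (fun t => F (s * t)%g)) = signed_sum false X N.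
  rewrite /N signed_sumC; apply: eq_signed_sum => k _; rewrite signed_sumC; apply: eq_signed_sum => t _.
  by apply: eq_signed_sum => k' _; apply: eq_signed_sum => t' _; rewrite !mulg1 mulgA.
have YC : [disjoint Y & C].
  by rewrite disjoints_subset subUset sub1set inE zC -disjoints_subset.
have NC k h : perm_on C k -> N (k * h)%g = N h.
  move=> kC; rewrite /N -[RHS]mul1r -[1 in RHS](_ : sgn false k = 1) //.
  rewrite -signed_sum_shiftr; last by apply: perm_onS kC; exact: subsetUr.
  apply: eq_signed_sum => k' _; apply: eq_signed_sum => t tY; apply: eq_signed_sum => t' _.
  by rewrite !mulgA -(mulgA k') (perm_on_comm YC tY kC) !mulgA.
have N1 : N 1%g = #|Y|`!%:R * M 1%g.
  rewrite /M /young_sum -signed_sumZ; apply: eq_signed_sum => k _.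
  apply: signed_sum_const => t tY.
  by rewrite -signed_sum_shiftl //; apply: eq_signed_sum => t' _; rewrite !mulgA !mulg1.
have NcB c : c \in C -> N (tperm z c) = #|B|`!%:R * M 1%g.
  move=> cC.
  have cz : c != z by apply: contraNneq zC => <-.
  have cB : c \notin B by rewrite (disjointFl BC).
  have E h : signed_sum false X (fun k => signed_sum true B (fun t => signed_sum true Y (fun t' =>
              F (k * (h * t) * tperm z c * t')%g))) = #|B|`!%:R * M (h * tperm z c)%g.
    rewrite /M /young_sum -signed_sumZ; apply: eq_signed_sum => k _.
    apply: signed_sum_const => t tB.
    rewrite -signed_sum_shiftl; last by apply: perm_onS tB; exact: subsetUr.
    apply: eq_signed_sum => t' _; rewrite !mulgA -(mulgA _ t (tperm z c)).
    by rewrite -tperm_comm ?(out_perm tB) // !mulgA.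
  (* The first column group is expanded along [z]. Each (z b)(z c) equals (z c)(c b), whose first
     factor is absorbed and whose second gives 0. *)
  transitivity (#|B|`!%:R * M (tperm z c) - \sum_(b in B) #|B|`!%:R * M (tperm z b * tperm z c)%g).
    rewrite -[in M (tperm z c)](mul1g (tperm z c)) -E.
    under eq_bigr => b _ do rewrite -E.
    rewrite -signed_sum_sum -mulN1r -signed_sumZ -signed_sumD; apply: eq_signed_sum => k _.
    rewrite {1}/Y signed_sum_insertl // expr1; congr (_ + _).
    by apply: eq_signed_sum => t _; rewrite mul1g.
  rewrite big1 ?subr0 => [|b bB].
    by rewrite -[tperm z c]mulg1 /M young_sum_absorbl // perm_on_tperm ?setU11 ?setU1r.
  have bz : b != z by apply: contraNneq zB => <-.
  have cb : c != b by apply: contraNneq cB => ->.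
  rewrite (conjgC (tperm z b)) tpermJ tpermL tpermD // 1?eq_sym //.
  rewrite /M young_sum_absorbl ?perm_on_tperm ?setU11 ?setU1r //.
  by rewrite (@young_sum_trans0 _ _ _ c z b) ?mulr0 // ?setU11 // setU1r.
rewrite NE signed_sum_insertr // expr0 mul1r.
have -> : signed_sum false C N = #|C|`!%:R * N 1%g.
  by apply: signed_sum_const => k kC; rewrite mul1r -{1}(mulg1 k) NC.
rewrite (eq_bigr (fun=> #|C|`!%:R * (#|B|`!%:R * M 1%g))) => [|c cC]; last first.
  rewrite -(NcB c) //; apply: signed_sum_const => k kC.
  by rewrite mul1r NC.
rewrite sumr_const N1 cardsU1 zB add1n factS -mulr_natl -/(M 1%g).
by rewrite -addSn !natrM natrD; ring.
Qed.

(* (z b) lies both in the column group of [B1] and in the row group of [B2]. *)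
Lemma young_sum_orth1 z A1 A2 B1 B2 b F : b \in B1 -> b \in A2 :\: B2 -> b != z ->
  young_sum (z |: (A1 :\: B1)) (z |: B1) 1%g
    (fun s => young_sum (z |: (A2 :\: B2)) (z |: B2) 1%g (fun t => F (s * t)%g)) = 0.
Proof.
move=> bB1 bB2 bz; apply: big1 => k _; rewrite (_ : signed_sum _ _ _ = 0) ?mulr0 //.
have P1 : perm_on (z |: B1) (tperm z b) by rewrite perm_on_tperm ?setU11 // setU1r.
have P2 : perm_on (z |: (A2 :\: B2)) (tperm z b).
  by rewrite perm_on_tperm ?setU11 // setU1r.
set S := signed_sum _ _ _.
have : - S = S; last by move=> ?; lra.
rewrite -mulN1r -[-1](sgn_tperm true (_ : z != b)) 1?eq_sym //.
rewrite -signed_sum_shiftr //; apply: eq_signed_sum => t _.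
rewrite -[RHS]mul1r -[1 in RHS](_ : sgn false (tperm z b) = 1) // -signed_sum_shiftl //.
by apply: eq_signed_sum => k' _; apply: eq_signed_sum => t' _; rewrite !mulg1 !mulgA.
Qed.

(** A point of [B1] outside [B2] kills the product in this order. If instead [B2] has a point
    outside [B1], the factors are first exchanged, which the class function [cycw] permits. *)
Lemma young_sum_orth z A B1 B2 : z \notin A -> B1 \subset A -> B2 \subset A -> B1 != B2 ->
  young_sum (z |: (A :\: B1)) (z |: B1) 1%g
    (fun s => young_sum (z |: (A :\: B2)) (z |: B2) 1%g (fun t => cycw x (s * t)%g)) = 0.
Proof.
move=> zA B1A B2A; rewrite eqEsubset negb_and => /orP[] /subsetPn[b bB nbB].
  have bA := subsetP B1A _ bB.
  apply: (@young_sum_orth1 _ _ _ _ _ b) => //; first by rewrite inE nbB.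
  by apply: contraNneq zA => <-.
have bA := subsetP B2A _ bB.
rewrite young_sumC -[RHS](@young_sum_orth1 z A A B2 B1 b (cycw x)) ?inE ?nbB //; last first.
  by apply: contraNneq zA => <-.
by apply: eq_young_sum => s; apply: eq_young_sum => t; rewrite cycwC.
Qed.

(** Products of the contents along the arm and the leg of a hook, corner excluded. *)
Definition rise (n : nat) : rat := \prod_(i < n) (x + i.+1%:R).
Definition fall (n : nat) : rat := \prod_(i < n) (x - i.+1%:R).

Lemma young_sum_trace z B C : z \notin B -> z \notin C -> [disjoint B & C] ->
  x ^+ (#|C| + #|B|) * young_sum (z |: C) (z |: B) 1%g (cycw x) = rise #|C| * fall #|B| * cycw x (1 : {perm T})%g.
Proof.
move=> zB zC BC.
have YC : [disjoint z |: B & C].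
  by rewrite disjoints_subset subUset sub1set inE zC -disjoints_subset.
rewrite exprD /young_sum signed_sumC -mulrA mulrCA -[in LHS]signed_sumZ.
have E t : perm_on (z |: B) t ->
    x ^+ #|C| * signed_sum false (z |: C) (fun k => cycw x (k * 1 * t)%g) = rise #|C| * cycw x (t * 1)%g.
  move=> tB; transitivity (x ^+ #|C| * signed_sum false (z |: C) (fun k => cycw x (k * t)%g)).
    by congr (_ * _); apply: eq_signed_sum => k _; rewrite mulg1.
  rewrite signed_sum_trace_all // => [|y yC]; last by rewrite (out_perm tB) // (disjointFl YC).
  by rewrite mulg1; congr (_ * _); apply: eq_bigr => i _; rewrite mul1r.
rewrite (eq_signed_sum _ E) signed_sumZ mulrCA signed_sum_trace_all // => [|y _]; last by rewrite perm1.
by rewrite mulrA; congr (_ * _ * _); apply: eq_bigr => i _; rewrite expr1 mulN1r.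
Qed.

Lemma sum_subset_card A (f : nat -> rat) :
  \sum_(B : {set T} | B \subset A) f #|B| = \sum_(b < #|A|.+1) 'C(#|A|, b)%:R * f b.
Proof.
rewrite (partition_big (fun B : {set T} => inord #|B| : 'I_#|A|.+1) predT) //=.
apply: eq_bigr => b _; rewrite -cards_draws mulr_natl -sumr_const.
apply: eq_big => [B|B].
  rewrite inE; case BA: (B \subset A) => //=.
  by rewrite -(inj_eq val_inj) /= inordK // ltnS subset_leq_card.
case/andP => BA /eqP <-.
by rewrite inordK // ltnS subset_leq_card.
Qed.

(** Only equal legs survive. The number of subsets of size b cancels the b! and (|A|-b)! of
    [young_sum_sqr], so one common (|A|+1)! remains. *)
Lemma hook_comb_mixed z A g1 g2 : z \notin A ->
  x ^+ #|A| * hook_comb z A g1 1%g (fun s => hook_comb z A g2 1%g (fun t => cycw x (s * t)%g)) =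
  (#|A|.+1)`!%:R * (\sum_(b < #|A|.+1) g1 b * g2 b * (rise (#|A| - b) * fall b)) * cycw x (1 : {perm T})%g.
Proof.
move=> zA.
have -> : hook_comb z A g1 1%g (fun s => hook_comb z A g2 1%g (fun t => cycw x (s * t)%g)) =
   \sum_(B : {set T} | B \subset A) g1 #|B| * g2 #|B| *
      ((#|A| - #|B|)`! * #|B|`! * #|A|.+1)%:R *
      young_sum (z |: (A :\: B)) (z |: B) 1%g (cycw x).
  apply: eq_bigr => B BA; rewrite young_sum_bigsum (bigD1 B) //= big1 ?addr0.
    rewrite young_sumZ young_sum_sqr.
    - by rewrite cardsD (setIidPr BA) subnKC ?subset_leq_card // !mulrA.
    - by apply: contra zA; apply/subsetP.
    - by rewrite inE (negbTE zA) andbF.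
    - by rewrite disjoint_sym -setI_eq0 setDE -setIA (setIC (~: B)) setICr setI0.
  move=> B2 /andP[B2A B21]; rewrite young_sumZ young_sum_orth ?mulr0 //.
  by rewrite eq_sym.
rewrite mulr_sumr.
rewrite (eq_bigr (fun B : {set T} => g1 #|B| * g2 #|B| *
      ((#|A| - #|B|)`! * #|B|`! * #|A|.+1)%:R * (rise (#|A| - #|B|) * fall #|B| * cycw x (1 : {perm T})%g))).
  rewrite (sum_subset_card A (fun b => g1 b * g2 b * ((#|A| - b)`! * b`! * #|A|.+1)%:R *
     (rise (#|A| - b) * fall b * cycw x (1 : {perm T})%g))) mulr_sumr mulr_suml.
  apply: eq_bigr => b _; have bA : (b <= #|A|)%N by rewrite -ltnS.
  rewrite factS -(bin_fact bA) !natrM; ring.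
move=> B BA.
have := @young_sum_trace z B (A :\: B).
rewrite cardsD (setIidPr BA) subnK ?subset_leq_card // => <-; first by rewrite mulrCA.
- by apply: contra zA; apply/subsetP.
- by rewrite inE (negbTE zA) andbF.
- by rewrite disjoint_sym -setI_eq0 setDE -setIA (setIC (~: B)) setICr setI0.
Qed.
End Mixed.

(** * Pairings of two rows *)

Section Pairs.
Variables (T : finType) (x : rat).
Implicit Types (X Y U V S R A B C : {set T}) (s t h r m k : {perm T}) (F G : {perm T} -> rat).
Implicit Types (z u v y : T) (g : nat -> rat).

Definition pairing_on S m :=
  perm_on S m && [forall z in S, (m z != z) && (m (m z) == z)].

Lemma pairing_onK S m : pairing_on S m -> involutive m.
Proof.
case/andP => mS /forall_inP mP y; have [yS|yS] := boolP (y \in S).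
  by have /andP[_ /eqP] := mP _ yS.
by rewrite !(out_perm mS).
Qed.

Lemma pairing_on_neq S m y : pairing_on S m -> y \in S -> m y != y.
Proof. by case/andP => _ /forall_inP mP /mP /andP[]. Qed.

(** Turns the pair of [u] into two fixed points, so that the ambient type stays the same while the
    rows shrink. *)
Definition unpair m u := (tperm u (m u) * m)%g.

Lemma unpairK m u : (tperm u (m u) * unpair m u)%g = m.
Proof. by rewrite /unpair mulgA tperm2 mul1g. Qed.

Lemma unpair_id S m u : pairing_on S m -> unpair m u u = u.
Proof. by move=> mP; rewrite permM tpermL (pairing_onK mP). Qed.

Lemma unpair_id2 m u : unpair m u (m u) = m u.
Proof. by rewrite permM tpermR. Qed.

Lemma unpairE m u y : y != u -> y != m u -> unpair m u y = m y.
Proof. by move=> yu ym; rewrite permM tpermD // eq_sym. Qed.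

Lemma unpair_on S m u : pairing_on S m -> u \in S ->
  pairing_on (S :\ u :\ m u) (unpair m u).
Proof.
move=> mP uS; have mK := pairing_onK mP; have /andP[mS _] := mP.
apply/andP; split.
  apply/subsetP => y; rewrite unfold_in !inE => yN.
  have [yu|yu] := eqVneq y u; first by rewrite yu (unpair_id u mP) eqxx in yN.
  have [ym|ym] := eqVneq y (m u); first by rewrite ym unpair_id2 eqxx in yN.
  by rewrite unpairE // in yN; apply: (subsetP mS).
apply/forall_inP => y; rewrite !inE => /and3P[ym yu yS].
rewrite (unpairE yu ym) (pairing_on_neq mP) // unpairE ?mK ?eqxx //.
  by apply: contraNneq ym => <-; rewrite mK.
by rewrite (inj_eq perm_inj).
Qed.

(** Each pair {y, m y} with y in [U] merges the fixed point [m y] of [s] into another cycle. *)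
Lemma pairing_join U m s : pairing_on (U :|: m @: U) m -> [disjoint U & m @: U] ->
  {in m @: U, forall y, s y = y} -> x ^+ #|U| * cycw x (s * m)%g = cycw x s.
Proof.
elim/set_insert_ind: U m => [|z U zU IH] m mP dU sU.
  have m1 : m = 1%g.
    apply: (perm_on_id (S := set0)); rewrite ?cards0 //.
    by move: mP; rewrite imset0 setU0 => /andP[].
  by rewrite m1 mulg1 cards0 mul1r.
have mK := pairing_onK mP.
have mz : m z != z by apply: (pairing_on_neq mP); rewrite !inE eqxx.
have mzU : m z \notin z |: U.
  by rewrite (disjointFl dU) // imset_f // setU11.
have UE : unpair m z @: U = m @: U.
  apply: eq_in_imset => y yU; rewrite unpairE //.
    by apply: contraNneq zU => <-.
  by apply: contraNneq mzU => <-; rewrite setU1r.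
have UmU : m @: U \subset m @: (z |: U) by rewrite imsetS // subsetUr.
have zmU : z \notin m @: U.
  by apply/negP => /(subsetP UmU); rewrite (disjointFr dU) // setU11.
have mzmU : m z \notin m @: U by rewrite mem_imset //; exact: perm_inj.
have mzU' : m z \notin U by apply: contra mzU => mzU; rewrite setU1r.
have SE : (z |: U :|: m @: (z |: U)) :\ z :\ m z = U :|: unpair m z @: U.
  rewrite UE imsetU1; apply/setP => y; rewrite !inE.
  have [->|ymz] := eqVneq y (m z); first by rewrite (negbTE mzU') (negbTE mzmU).
  by have [->|yz] := eqVneq y z; rewrite ?(negbTE zU) ?(negbTE zmU).
have := IH (unpair m z); rewrite -SE UE => <-.
- rewrite cardsU1 zU exprSr -mulrA; congr (_ * _).
  rewrite -{1}(unpairK m z) mulgA tpermC.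
  rewrite cycw_join //; first by rewrite sU // imset_f // setU11.
    exact: unpair_id2.
  by rewrite eq_sym.
- by apply: unpair_on; rewrite ?setUA // !inE eqxx.
- by apply: disjointW dU; rewrite // subsetUr.
- by move=> y yU; apply: sU; apply: (subsetP UmU).
Qed.

Lemma young_sum_imset m X Y F :
  young_sum (m @: X) (m @: Y) 1%g F = young_sum X Y 1%g (fun s => F (s ^ m)%g).
Proof.
rewrite /young_sum signed_sum_conj; apply: eq_signed_sum => k _; rewrite signed_sum_conj.
by apply: eq_signed_sum => t _; rewrite !mulg1 conjMg.
Qed.

Lemma imset_permD m A B : m @: (A :\: B) = (m @: A) :\: (m @: B).
Proof.
apply/setP => y; rewrite -(permKV m y) !inE !mem_imset ?inE //; exact: perm_inj.
Qed.

Lemma hook_comb_imset m z A g F :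
  hook_comb (m z) (m @: A) g 1%g F = hook_comb z A g 1%g (fun s => F (s ^ m)%g).
Proof.
rewrite /hook_comb (reindex_inj (imset_inj (@perm_inj _ m))) /=; apply: eq_big => [B|B BA].
  apply/subsetP/subsetP => [BA y yB|BA _ /imsetP[y yB ->]]; last by rewrite imset_f // BA.
  by have := BA (m y); rewrite !mem_imset ?yB; try exact: perm_inj; apply.
rewrite card_imset; last exact: perm_inj.
by rewrite -imset_permD -!imsetU1 young_sum_imset.
Qed.

Lemma eq_hook_comb z A g F G : (forall s, perm_on (z |: A) s -> F s = G s) ->
  hook_comb z A g 1%g F = hook_comb z A g 1%g G.
Proof.
move=> FG; apply: eq_bigr => B BA; congr (_ * _).
apply: eq_signed_sum => k kP; apply: eq_signed_sum => t tP; apply: FG.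
rewrite mulg1 perm_onM //; [apply: perm_onS kP | apply: perm_onS tP]; apply: setUS => //.
exact: subsetDl.
Qed.

Lemma hook_combZ z A g c F : hook_comb z A g 1%g (fun s => c * F s) = c * hook_comb z A g 1%g F.
Proof. by rewrite mulr_sumr; apply: eq_bigr => B _; rewrite young_sumZ mulrCA. Qed.

Lemma hook_comb_swap z A g z' A' g' (F : {perm T} -> {perm T} -> rat) :
  hook_comb z A g 1%g (fun s => hook_comb z' A' g' 1%g (F s)) =
  hook_comb z' A' g' 1%g (fun t => hook_comb z A g 1%g (F^~ t)).
Proof.
rewrite /hook_comb.
under eq_bigr => B _.
  rewrite young_sum_bigsum mulr_sumr.
  under eq_bigr => B' _ do rewrite young_sumZ mulrCA young_sumC.
  over.
rewrite exchange_big /=; apply: eq_bigr => B' _.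
rewrite young_sum_bigsum mulr_sumr; apply: eq_bigr => B _.
by rewrite young_sumZ.
Qed.

(** Once the second row is written as a conjugate by [m], the argument s(m t m)m = s m t has as many
    cycles as (t s)m. As t s lives on the first row, the mixed pairs cost |A|+1 merges; the other
    |A| powers of x come from [hook_comb_mixed]. *)
Lemma hook_comb_mixed_rows z A m g1 g2 : z \notin A ->
  pairing_on (z |: A :|: m @: (z |: A)) m -> [disjoint z |: A & m @: (z |: A)] ->
  x ^+ (#|A|.*2.+1) *
    hook_comb z A g1 1%g (fun s => hook_comb (m z) (m @: A) g2 1%g (fun t => cycw x (s * t * m)%g)) =
  (#|A|.+1)`!%:R * (\sum_(b < #|A|.+1) g1 b * g2 b * (rise x (#|A| - b) * fall x b))
    * cycw x (1 : {perm T})%g.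
Proof.
move=> zA mP dU; rewrite -(hook_comb_mixed _ _ _ zA) -addnn -addSn addnC exprD -mulrA; congr (_ * _).
rewrite -hook_combZ; apply: eq_hook_comb => s sA; rewrite -hook_combZ hook_comb_imset; apply: eq_hook_comb => t tA.
have mm : (m * m = 1)%g.
  by apply/permP => y; rewrite permM perm1 (pairing_onK mP).
have -> : (#|A|.+1 = #|z |: A|)%N by rewrite cardsU1 zA.
have mV : (m^-1 = m)%g by rewrite -[LHS]mulg1 -mm mulKg.
rewrite conjgE mV !mulgA -(mulgA _ m m) mm mulg1.
rewrite [in LHS]cycwC mulgA pairing_join ?(cycwC _ s t) // => y ymA.
by rewrite permM !(@out_perm _ (z |: A)) // (disjointFl dU).
Qed.
End Pairs.

(** * Deleting all non-mixed pairs of both rows *)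

Section TwoRows.
Variables (T : finType) (x : rat).
Hypothesis x0 : x != 0.
Implicit Types (X Y U V S R A B C : {set T}) (s t h r m k : {perm T}) (F G : {perm T} -> rat).
Implicit Types (z u v y : T) (g : nat -> rat).

(** After a deletion that leaves q' pairs, [n + q'.*2] non-root points remain, as [pair_step]
    expects. *)
Fixpoint pair_iter n q g : nat -> rat :=
  if q is q'.+1 then pair_iter n q' (pair_step x (n + q'.*2) g) else g.

Definition inner A m := [set y in A | m y \in A].

(** Here [n] counts the mixed pairs other than the root pair {z1, z2}; it is s - 1 in the
    application. *)
Definition two_rows z1 A1 z2 A2 m n q1 q2 : Prop :=
  [/\ z1 \notin A1, z2 \notin A2, [disjoint z1 |: A1 & z2 |: A2],
      pairing_on ((z1 |: A1) :|: (z2 |: A2)) m & m z1 = z2] /\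
  [/\ #|A1| = (n + q1.*2)%N, #|A2| = (n + q2.*2)%N,
      #|inner A1 m| = q1.*2 & #|inner A2 m| = q2.*2].

Definition row_sum z1 A1 z2 A2 m g1 g2 : rat :=
  hook_comb z1 A1 g1 1%g (fun s => hook_comb z2 A2 g2 1%g (fun t => cycw x (s * t * m)%g)).

Lemma two_rows_swap z1 A1 z2 A2 m n q1 q2 :
  two_rows z1 A1 z2 A2 m n q1 q2 -> two_rows z2 A2 z1 A1 m n q2 q1.
Proof.
move=> [[zA1 zA2 dR mP mz] [c1 c2 i1 i2]]; do 2!split => //.
- by rewrite disjoint_sym.
- by rewrite setUC.
- by rewrite -mz (pairing_onK mP).
Qed.

Lemma row_sum_swap z1 A1 z2 A2 m g1 g2 : [disjoint z1 |: A1 & z2 |: A2] ->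
  row_sum z1 A1 z2 A2 m g1 g2 = row_sum z2 A2 z1 A1 m g2 g1.
Proof.
move=> dR; rewrite /row_sum hook_comb_swap; apply: eq_hook_comb => t tP; apply: eq_hook_comb => s sP.
by rewrite (perm_on_comm dR sP tP).
Qed.

Lemma two_rows0 z1 A1 z2 A2 m n : two_rows z1 A1 z2 A2 m n 0 0 -> m @: A1 = A2.
Proof.
move=> [[zA1 zA2 dR mP mz] [c1 c2 i1 i2]].
have mK := pairing_onK mP; have /andP[mS _] := mP.
apply/eqP; rewrite eqEcard card_imset ?c1 ?c2 ?leqnn; last exact: perm_inj.
rewrite andbT; apply/subsetP => _ /imsetP[y yA ->].
have : m y \in (z1 |: A1) :|: (z2 |: A2).
  by rewrite (perm_closed _ mS) !inE yA orbT.
have /setP/(_ y) : inner A1 m = set0 by apply/eqP; rewrite -cards_eq0 i1.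
rewrite !inE yA /= => -> /orP[/orP[/eqP myz|//]|/orP[/eqP myz|//]].
  have yz : y = z2 by rewrite -(mK y) myz mz.
  have : y \in z2 |: A2 by rewrite yz setU11.
  by rewrite (disjointFr dR) // setU1r.
have yz : y = z1 by apply: (@perm_inj _ m); rewrite myz mz.
by rewrite -yz yA in zA1.
Qed.

Lemma row_step z1 A1 z2 A2 m n q1 q2 g1 g2 : two_rows z1 A1 z2 A2 m n q1.+1 q2 ->
  exists A1' m', two_rows z1 A1' z2 A2 m' n q1 q2 /\
    x ^+ 2 * row_sum z1 A1 z2 A2 m g1 g2 =
    row_sum z1 A1' z2 A2 m' (pair_step x (n + q1.*2) g1) g2.
Proof.
move=> [[zA1 zA2 dR mP mz] [c1 c2 i1 i2]].
have mK := pairing_onK mP; have /andP[mS _] := mP.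
have /card_gt0P[u] : (0 < #|inner A1 m|)%N by rewrite i1.
rewrite inE => /andP[uA vA].
have uR : u \in z1 |: A1 :|: (z2 |: A2) by rewrite !inE uA orbT.
have vu : m u != u := pairing_on_neq mP uR.
have NR2 y : y \in A1 -> y \notin z2 |: A2.
  by move=> yA; rewrite (disjointFr dR) // setU1r.
pose A := A1 :\ u :\ m u; exists A, (unpair m u).
have AE : A1 = u |: (m u |: A).
  by rewrite setD1K ?setD1K // !inE vu.
have uz : u != z1 by apply: contraNneq zA1 => <-.
have vz : m u != z1 by apply: contraNneq zA1 => <-.
have uzA : u \notin z1 |: A by rewrite !inE negb_or uz eqxx /= andbF.
have vzA : m u \notin z1 |: A by rewrite !inE negb_or vz eqxx.
have zA : z1 \notin A by rewrite !inE (negbTE zA1) !andbF.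
have uvA : u \notin m u |: A by rewrite !inE eqxx andbF orbF eq_sym.
have vA' : m u \notin A by rewrite !inE eqxx.
have cA : #|A| = (n + q1.*2)%N.
  have vA1 : m u \in A1 :\ u by rewrite !inE vu.
  by move: c1; rewrite (cardsD1 u) uA (cardsD1 (m u)) vA1 !add1n doubleS !addnS => -[].
split.
  split; split => //.
  - apply: disjointWl dR; apply: setUS.
    exact: subset_trans (subsetDl _ _) (subsetDl _ _).
  - have -> : z1 |: A :|: (z2 |: A2) = (z1 |: A1 :|: (z2 |: A2)) :\ u :\ m u.
      have := NR2 _ uA; have := NR2 _ vA; rewrite !in_setU1 !negb_or.
      move=> /andP[vz2 vA2] /andP[uz2 uA2].
      apply/setP => y; rewrite !inE.
      have [->|yv] := eqVneq y (m u); first by rewrite (negbTE vz) (negbTE vz2) (negbTE vA2).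
      have [->|yu] := eqVneq y u; first by rewrite (negbTE uz) (negbTE uz2) (negbTE uA2).
      by [].
    exact: unpair_on.
  - rewrite unpairE // 1?eq_sym //.
  - have -> : inner A (unpair m u) = inner A1 m :\ u :\ m u.
      apply/setP => y; rewrite !inE.
      have [->|yv] := eqVneq y (m u); first by rewrite ?andbF.
      have [->|yu] := eqVneq y u; first by rewrite ?andbF.
      rewrite /= unpairE // (inj_eq perm_inj) yu.
      have -> : m y != u by apply: contraNneq yv => <-; rewrite mK.
      by [].
    have uI : u \in inner A1 m by rewrite inE uA.
    have vI : m u \in inner A1 m :\ u by rewrite !inE vu vA mK.
    by move: i1; rewrite (cardsD1 u) uI (cardsD1 (m u)) vI !add1n doubleS => -[].
  - rewrite -i2; apply: eq_card => y; rewrite !inE; case yA2: (y \in A2) => //=.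
    rewrite unpairE //; first by apply: contraTneq yA2 => ->; apply: contra (NR2 _ uA) => ?; rewrite setU1r.
    by apply: contraTneq yA2 => ->; apply: contra (NR2 _ vA) => ?; rewrite setU1r.
rewrite /row_sum hook_comb_swap [in RHS]hook_comb_swap -hook_combZ; apply: eq_hook_comb => t tP.
have tu : t u = u by rewrite (out_perm tP) // NR2.
have tv : t (m u) = m u by rewrite (out_perm tP) // NR2.
(* The permutation [t] of the other row times the shortened pairing serves as [r]; both fix [u] and
   [m u]. *)
have := @hook_comb_step T x z1 A g1 u (m u) (t * unpair m u)%g x0 zA uzA vzA.
have ru : (t * unpair m u)%g u = u by rewrite permM tu (unpair_id _ mP).
have rv : (t * unpair m u)%g (m u) = m u by rewrite permM tv unpair_id2.
rewrite eq_sym cA -AE => /(_ vu ru rv) E.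
transitivity (x ^+ 2 * hook_comb z1 A1 g1 1%g
  (fun s => cycw x (s * (tperm u (m u) * (t * unpair m u)))%g)).
  congr (_ * _); apply: eq_hook_comb => s _; congr (cycw x _).
  by rewrite -{1}(unpairK m u) !mulgA -(mulgA s) tperm_comm // !mulgA.
by rewrite E; apply: eq_hook_comb => s _; rewrite !mulgA.
Qed.

Definition row_value n g1 g2 : rat :=
  (n.+1)`!%:R * (\sum_(b < n.+1) g1 b * g2 b * (rise x (n - b) * fall x b))
    * cycw x (1 : {perm T})%g.

Lemma row_valueC n g1 g2 : row_value n g1 g2 = row_value n g2 g1.
Proof.
by congr (_ * _ * _); apply: eq_bigr => b _; rewrite (mulrC (g1 _)).
Qed.

(** Pairs are deleted from the first row only, the case q1 = 0 being a hypothesis. [row_sumE]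
    obtains that case from this same lemma with the rows exchanged. *)
Lemma row_sum_induct n q2 :
  (forall z1 A1 z2 A2 m g1 g2, two_rows z1 A1 z2 A2 m n 0 q2 ->
    x ^+ (q2.*2 + n.*2.+1) * row_sum z1 A1 z2 A2 m g1 g2 = row_value n g1 (pair_iter n q2 g2)) ->
  forall q1 z1 A1 z2 A2 m g1 g2, two_rows z1 A1 z2 A2 m n q1 q2 ->
    x ^+ (q1.*2 + q2.*2 + n.*2.+1) * row_sum z1 A1 z2 A2 m g1 g2 =
    row_value n (pair_iter n q1 g1) (pair_iter n q2 g2).
Proof.
move=> H0; elim=> [|q1 IH] z1 A1 z2 A2 m g1 g2 Hr; first exact: H0.
have [A1' [m' [Hr' E]]] := row_step g1 g2 Hr.
by rewrite /= -(IH _ _ _ _ _ _ _ Hr') -E mulrA -exprD; congr (_ ^+ _ * _); rewrite doubleS !addSn addn2.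
Qed.

Lemma row_sumE n q1 q2 z1 A1 z2 A2 m g1 g2 : two_rows z1 A1 z2 A2 m n q1 q2 ->
    x ^+ (q1.*2 + q2.*2 + n.*2.+1) * row_sum z1 A1 z2 A2 m g1 g2 =
    row_value n (pair_iter n q1 g1) (pair_iter n q2 g2).
Proof.
apply: row_sum_induct => {}z1 {}A1 {}z2 {}A2 {}m {}g1 {}g2 Hr.
have dR : [disjoint z1 |: A1 & z2 |: A2] by case: Hr => -[].
rewrite row_sum_swap // row_valueC -[q2.*2]addn0.
apply: (row_sum_induct (q2 := 0)) (two_rows_swap Hr).
move=> {z1 A1 z2 A2 m g1 g2 q2 dR Hr}z1 A1 z2 A2 m g1 g2 Hr.
have := two_rows0 Hr; have [[zA1 zA2 dR mP mz] [c1 c2 i1 i2]] := Hr.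
move=> mA; rewrite /row_sum -mz -mA /row_value /=.
have <- : #|A1| = n by rewrite c1 addn0.
by rewrite add0n hook_comb_mixed_rows // imsetU1 mA mz.
Qed.
End TwoRows.

(** * The number of pairings *)

Section CountPairings.
Variables (T : finType).
Implicit Types (S A B : {set T}) (m : {perm T}) (a b y : T).

Lemma pairing_on_tperm S m a b : a \in S -> b \in S -> a != b ->
  pairing_on S (tperm a b * m)%g && ((tperm a b * m)%g a == b) =
  pairing_on (S :\ a :\ b) m.
Proof.
move=> aS bS ab; apply/andP/idP => [[mP /eqP mab]|mP].
  have -> : m = unpair (tperm a b * m)%g a by rewrite /unpair mab mulgA tperm2 mul1g.
  by rewrite -{1}mab; exact: unpair_on.
have mK := pairing_onK mP; have /andP[mS _] := mP.
have ma : m a = a by rewrite (out_perm mS) // !inE eqxx andbF.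
have mb : m b = b by rewrite (out_perm mS) // !inE eqxx.
split; last by rewrite permM tpermL mb.
apply/andP; split.
  rewrite perm_onM ?perm_on_tperm //; apply: perm_onS mS.
  exact: subset_trans (subsetDl _ _) (subsetDl _ _).
apply/forall_inP => y yS; rewrite !permM.
have [->|ya] := eqVneq y a; first by rewrite tpermL mb tpermR ma eq_sym ab eqxx.
have [->|yb] := eqVneq y b; first by rewrite tpermR ma tpermL mb ab eqxx.
have myN c : m c = c -> y != c -> m y != c by by move=> mc; rewrite -{2}mc (inj_eq perm_inj).
have -> : tperm a b y = y by rewrite tpermD // eq_sym.
have -> : tperm a b (m y) = m y by rewrite tpermD // eq_sym myN.
rewrite mK eqxx andbT.
by apply: (pairing_on_neq mP); rewrite !inE ya yb.
Qed.

Definition pairings A B q1 q2 : {set {perm T}} :=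
  [set m | [&& pairing_on (A :|: B) m, #|inner A m| == q1.*2 & #|inner B m| == q2.*2]].

Lemma pairingsC A B q1 q2 : pairings A B q1 q2 = pairings B A q2 q1.
Proof. by apply/setP => m; rewrite !inE setUC; congr (_ && _); rewrite andbC. Qed.

Lemma card_pairings_fiber A B q1 q2 a b C D r1 r2 :
  a \in A :|: B -> b \in A :|: B -> a != b -> C :|: D = (A :|: B) :\ a :\ b ->
  (forall m, pairing_on (A :|: B) (tperm a b * m)%g -> (tperm a b * m)%g a = b ->
     (#|inner A (tperm a b * m)%g| == q1.*2) = (#|inner C m| == r1.*2) /\
     (#|inner B (tperm a b * m)%g| == q2.*2) = (#|inner D m| == r2.*2)) ->
  #|[set m in pairings A B q1 q2 | m a == b]| = #|pairings C D r1 r2|.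
Proof.
move=> aS bS ab CD H; rewrite -(card_imset _ (mulgI (tperm a b))).
apply: eq_card => m; apply/idP/idP => [|mP].
  case/imsetP => m' + ->; rewrite !inE => /andP[/and3P[mP i1 i2] mab].
  have ttm : (tperm a b * (tperm a b * m') = m')%g by rewrite mulgA tperm2 mul1g.
  have := H (tperm a b * m')%g; rewrite ttm => /(_ mP (eqP mab)) [<- <-].
  by rewrite i1 i2 CD -pairing_on_tperm // ttm mP mab.
have -> : m = (tperm a b * (tperm a b * m))%g by rewrite mulgA tperm2 mul1g.
move: mP; rewrite inE => /and3P[mP i1 i2].
rewrite CD -pairing_on_tperm // in mP; case/andP: mP => mP mab.
have [e1 e2] := H _ mP (eqP mab).
by rewrite imset_f // !inE mP e1 e2 i1 i2 mab.
Qed.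

Lemma inner_unpair1 S A m a : pairing_on S m -> a \in S -> a \in A -> m a \in A ->
  #|inner A m| = #|inner (A :\ a :\ m a) (unpair m a)|.+2.
Proof.
move=> mP aS aA maA; have mK := pairing_onK mP.
have -> : inner (A :\ a :\ m a) (unpair m a) = inner A m :\ a :\ m a.
  apply/setP => y; rewrite !inE.
  have [->|yv] := eqVneq y (m a); first by rewrite ?andbF.
  have [->|yu] := eqVneq y a; first by rewrite ?andbF.
  rewrite /= unpairE // (inj_eq perm_inj) yu.
  by have -> : m y != a by apply: contraNneq yv => <-; rewrite mK.
have aI : a \in inner A m by rewrite inE aA.
have maI : m a \in inner A m :\ a by rewrite !inE (pairing_on_neq mP) // maA mK.
by rewrite (cardsD1 a) aI (cardsD1 (m a)) maI.
Qed.

Lemma inner_unpair2 A m a : a \notin A -> m a \notin A ->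
  inner A (unpair m a) = inner A m.
Proof.
move=> aA maA; apply/setP => y; rewrite !inE; case yA: (y \in A) => //=.
by rewrite unpairE //; apply: contraTneq yA => ->.
Qed.

Lemma inner_unpair3 S A m a : pairing_on S m -> a \in A -> m a \notin A ->
  inner (A :\ a) (unpair m a) = inner A m.
Proof.
move=> mP aA maA; have mK := pairing_onK mP; apply/setP => y; rewrite !inE.
have [->|ya] := eqVneq y a; first by rewrite (negbTE maA) andbF.
case yA: (y \in A) => //=.
have yma : y != m a by apply: contraTneq yA => ->.
rewrite unpairE // andb_idl // => _.
by apply: contraNneq yma => <-; rewrite mK.
Qed.

Lemma inner_unpair4 S A m a : pairing_on S m -> m a \in A -> a \notin A ->
  inner (A :\ m a) (unpair m a) = inner A m.
Proof.
move=> mP maA aA; have mK := pairing_onK mP.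
have -> : unpair m a = unpair m (m a) by rewrite /unpair mK tpermC.
by apply: inner_unpair3 mP maA _; rewrite mK.
Qed.

(** Induction through the partner of a point [a] of [A]. With p1 = |A| and p2 = |B|, the p1 - 1
    partners in [A] contribute 2 q1 (p1-1)! p2! to the right-hand side and the p2 partners in [B]
    contribute s (p1-1)! p2!; the sum is p1! p2! because p1 = 2 q1 + s. *)
Lemma card_pairings A B q1 q2 s : [disjoint A & B] ->
  #|A| = (q1.*2 + s)%N -> #|B| = (q2.*2 + s)%N ->
  (#|pairings A B q1 q2| * (q1`! * q2`! * 2 ^ (q1 + q2) * s`!) =
   (q1.*2 + s)`! * (q2.*2 + s)`!)%N.
Proof.
have [n] := ubnP (#|A| + #|B|)%N; elim: n A B q1 q2 s => // n IH A B q1 q2 s ltn dAB cA cB.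
wlog : A B q1 q2 dAB cA cB ltn / A != set0 => [WL|A0].
  have [A0|] := eqVneq A set0; last exact: WL.
  have [B0|B0] := eqVneq B set0; last first.
    rewrite disjoint_sym in dAB; rewrite addnC in ltn.
    by rewrite pairingsC [RHS]mulnC -(WL B A) // (mulnC q1`!) (addnC q1).
  move: cA cB; rewrite A0 B0 cards0 => /esym/eqP + /esym/eqP; rewrite !addn_eq0 !double_eq0.
  move=> /andP[/eqP -> /eqP ->] /andP[/eqP -> _]; rewrite !muln1.
  rewrite (_ : pairings _ _ _ _ = [set 1%g]) ?cards1 //; apply/setP => m; rewrite !inE setU0.
  have -> : inner set0 m = set0 by apply/setP => y; rewrite !inE.
  rewrite cards0 !andbT; apply/idP/eqP => [/andP[mS _]|->].
    by apply: perm_on_id mS _; rewrite cards0.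
  by rewrite /pairing_on perm_on1; apply/forall_inP => y; rewrite inE.
have [a aA] := set0Pn _ A0.
have aNB : a \notin B by rewrite (disjointFr dAB).
have aS : a \in A :|: B by rewrite inE aA.
have BNA y : y \in B -> y \notin A by move=> yB; rewrite (disjointFl dAB).
have ANB y : y \in A -> y \notin B by move=> yA; rewrite (disjointFr dAB).
have split_card : #|pairings A B q1 q2| =
    (\sum_(b in A :\ a) #|[set m in pairings A B q1 q2 | m a == b]| +
     \sum_(b in B) #|[set m in pairings A B q1 q2 | m a == b]|)%N.
  transitivity (\sum_(b in A :\ a :|: B) #|[set m in pairings A B q1 q2 | m a == b]|)%N;
    last first.
    rewrite -bigU /=; first by apply: eq_bigl => y; rewrite !inE.
    by rewrite disjoints_subset; apply/subsetP => y; rewrite !inE => /andP[_ /ANB].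
  rewrite -sum1_card (partition_big (fun m : {perm T} => m a) (mem (A :\ a :|: B))) /=.
    by apply: eq_bigr => b _; rewrite -sum1_card; apply: eq_bigl => m; rewrite inE.
  move=> m; rewrite inE => /andP[mP _]; have /andP[mS _] := mP.
  have := perm_closed a mS; rewrite aS !inE => /orP[-> |->]; rewrite ?orbT //.
  by rewrite (pairing_on_neq mP).
have unpairM b m : (tperm a b * m)%g a = b -> unpair (tperm a b * m)%g a = m.
  by move=> Mb; rewrite /unpair Mb mulgA tperm2 mul1g.
have fibA b : b \in A :\ a ->
    (#|[set m in pairings A B q1 q2 | m a == b]| * (q1`! * q2`! * 2 ^ (q1 + q2) * s`!) =
     q1.*2 * (q1.*2 + s).-2`! * (q2.*2 + s)`!)%N.
  rewrite !inE => /andP[ba bA].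
  case: q1 cA split_card => [|q1'] cA _.
    rewrite (_ : [set _ in _ | _] = set0) ?cards0 //; apply/setP => m; rewrite !inE.
    apply/negP => /andP[/and3P[_ + _] /eqP ma]; rewrite cards_eq0 => /eqP/setP/(_ a).
    by rewrite !inE aA ma bA.
  have -> : #|[set m in pairings A B q1'.+1 q2 | m a == b]| = #|pairings (A :\ a :\ b) B q1' q2|.
    apply: card_pairings_fiber => //; first by rewrite inE bA.
    - by rewrite eq_sym.
    - apply/setP => y; rewrite !inE.
      have [->|yb] := eqVneq y b; first by rewrite (negbTE (ANB _ bA)).
      by have [->|ya] := eqVneq y a; rewrite ?(negbTE aNB).
    - move=> m MP Mab; rewrite (inner_unpair1 MP aS) ?Mab //; split.
        by rewrite unpairM // doubleS.
      by rewrite -(inner_unpair2 (a := a)) ?unpairM // Mab ANB.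
  have bA' : b \in A :\ a by rewrite !inE ba.
  have cA' : #|A :\ a :\ b| = (q1'.*2 + s)%N.
    by move: cA; rewrite (cardsD1 a) aA (cardsD1 b) bA' !add1n doubleS !addSn => -[].
  have dAB' : [disjoint A :\ a :\ b & B].
    by apply: disjointWl dAB; exact: subset_trans (subsetDl _ _) (subsetDl _ _).
  have ltn' : (#|A :\ a :\ b| + #|B| < n)%N.
    by move: ltn; rewrite (cardsD1 a A) aA (cardsD1 b) bA' !add1n !addSn !ltnS => /ltnW.
  have := IH _ _ _ _ _ ltn' dAB' cA' cB.
  move=> H; rewrite doubleS !addSn /= factS expnS.
  transitivity (q1'.*2.+2 * ((q1'.*2 + s)`! * (q2.*2 + s)`!))%N; last by rewrite mulnA.
  rewrite -H -muln2; ring.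
have fibB b : b \in B ->
    (#|[set m in pairings A B q1 q2 | m a == b]| * (q1`! * q2`! * 2 ^ (q1 + q2) * s`!) =
     s * (q1.*2 + s).-1`! * (q2.*2 + s).-1`!)%N.
  clear fibA; move=> bB; case: s cA cB => [|s'] cA cB.
    rewrite (_ : [set _ in _ | _] = set0) ?cards0 //; apply/setP => m; rewrite !inE.
    apply/negP => /andP[/and3P[_ + _] /eqP ma]; rewrite -[q1.*2]addn0 -cA => /eqP cI.
    have /eqP/setP/(_ a) : inner A m == A.
      by rewrite eqEcard cI leqnn andbT; apply/subsetP => y; rewrite inE => /andP[].
    by rewrite inE aA ma (negbTE (BNA _ bB)).
  have ab : a != b by apply: contraNneq aNB => ->.
  have -> : #|[set m in pairings A B q1 q2 | m a == b]| = #|pairings (A :\ a) (B :\ b) q1 q2|.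
    apply: card_pairings_fiber => //; first by rewrite inE bB orbT.
    - apply/setP => y; rewrite !inE.
      have [->|yb] := eqVneq y b; first by rewrite (negbTE (BNA _ bB)) ?andbF.
      by have [->|ya] := eqVneq y a; rewrite ?(negbTE aNB).
    - move=> m MP Mab; split.
        by rewrite -(inner_unpair3 MP aA) ?unpairM // Mab BNA.
      by have := inner_unpair4 (A := B) (a := a) MP; rewrite Mab unpairM // => ->.
  have cA' : #|A :\ a| = (q1.*2 + s')%N.
    by move: cA; rewrite (cardsD1 a) aA add1n addnS => -[].
  have cB' : #|B :\ b| = (q2.*2 + s')%N.
    by move: cB; rewrite (cardsD1 b) bB add1n addnS => -[].
  have dAB' : [disjoint A :\ a & B :\ b].
    by apply: disjointW dAB; exact: subsetDl.
  have ltn' : (#|A :\ a| + #|B :\ b| < n)%N.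
    move: ltn; rewrite (cardsD1 a A) aA (cardsD1 b B) bB !add1n addSn addnS !ltnS; exact: ltnW.
  have := IH _ _ _ _ _ ltn' dAB' cA' cB'.
  move=> H; rewrite !addnS /= factS.
  transitivity (s'.+1 * ((q1.*2 + s')`! * (q2.*2 + s')`!))%N; last by rewrite mulnA.
  rewrite -H; ring.
rewrite split_card mulnDl !big_distrl /= (eq_bigr _ fibA) (eq_bigr _ fibB) !sum_nat_const.
have -> : #|A :\ a| = (q1.*2 + s).-1 by rewrite -cA (cardsD1 a A) aA.
rewrite cB; move: cA; rewrite (cardsD1 a) aA add1n.
clear; case: s => [|s'].
  by rewrite addn0; case: q1 => [|q1'] // _; rewrite doubleS /= !factS; ring.
move=> _; rewrite !addnS /= !factS; set f := (q1.*2 + s')`!.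
have E : ((q1.*2 + s') * (q1.*2 * (q1.*2 + s').-1`!) = q1.*2 * f)%N.
  rewrite /f mulnCA; clear; case: q1 => [|q1']; first by rewrite double0 !mul0n.
  by rewrite doubleS !addSn /= factS.
transitivity ((q2.*2 + s').+1 * (q2.*2 + s')`! *
   ((q1.*2 + s') * (q1.*2 * (q1.*2 + s').-1`!) + s'.+1 * f))%N; last rewrite E; ring.
Qed.
End CountPairings.

(** * The generating series as a sum over hooks *)

Section Annulus.
Variables p1 p2 : nat.
Local Notation T := (points p1 p2).
Implicit Types (m s h : {perm T}) (y z : T).

Definition label_class (i : nat) : {set T} := [set z : T | label z == i].

Lemma label_disjoint : [disjoint label_class 1%N & label_class 2%N].
Proof. by rewrite disjoints_subset; apply/subsetP => -[j|j]; rewrite !inE. Qed.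

Lemma label_cover : label_class 1%N :|: label_class 2%N = setT.
Proof. by apply/setP => -[j|j]; rewrite !inE. Qed.

Lemma card_label1 : #|label_class 1%N| = p1.
Proof.
rewrite -[RHS](card_ord p1) -cardsT -(card_imset [set: 'I_p1] (@inl_inj 'I_p1 'I_p2)).
apply: eq_card => -[j|j]; rewrite !inE /=; apply/esym; first exact: imset_f.
by apply/negP => /imsetP[].
Qed.

Lemma card_label2 : #|label_class 2%N| = p2.
Proof.
rewrite -[RHS](card_ord p2) -cardsT -(card_imset [set: 'I_p2] (@inr_inj 'I_p1 'I_p2)).
apply: eq_card => -[j|j]; rewrite !inE /=; apply/esym; last exact: imset_f.
by apply/negP => /imsetP[].
Qed.

Lemma is_pairingE m : is_pairing m = pairing_on (label_class 1%N :|: label_class 2%N) m.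
Proof.
rewrite label_cover /pairing_on (_ : perm_on _ _); last by apply/subsetP => y _; rewrite inE.
by apply/forallP/forall_inP => [mP y _|mP y]; apply: mP; rewrite ?inE.
Qed.

Lemma mem_pairs m y : [set y; m y] \in pairs m.
Proof. by apply/imsetP; exists y. Qed.

Lemma sub_pairs_card m (P : {set {set T}}) (D : {set T}) : is_pairing m ->
  P \subset pairs m -> cover P = D -> #|D| = (#|P| * 2)%N.
Proof.
move=> mP PS <-; have [/and3P[_ tI n0] c2] := pairs_partition mP.
rewrite (@card_uniform_partition _ 2 P (cover P)) // => [B BP|].
  by apply: c2; apply: (subsetP PS).
rewrite /partition eqxx (trivIsetS PS) //=; apply: contra n0; exact: (subsetP PS).
Qed.

Lemma card_nonmixed m i : is_pairing m ->
  #|inner (label_class i) m| = #|nonmixed_pairs m i|.*2.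
Proof.
move=> mP; rewrite -muln2; apply: (sub_pairs_card mP).
  by apply/subsetP => B; rewrite inE => /andP[].
apply/setP => y; apply/bigcupP/idP => [[B]|].
  rewrite inE => /andP[/imsetP[z _ ->] /forall_inP lz]; rewrite !inE.
  have /forallP/(_ z)/andP[_ /eqP mmz] := mP.
  by case/orP => /eqP ->; rewrite ?mmz !lz ?inE ?eqxx ?orbT.
rewrite !inE => /andP[/eqP ly lmy]; exists [set y; m y]; last by rewrite !inE eqxx.
rewrite inE mem_pairs /=; apply/forall_inP => z; rewrite !inE.
by case/orP => /eqP ->; rewrite // ly.
Qed.

Lemma card_mixed m : is_pairing m ->
  (#|inner (label_class 1%N) m| + #|inner (label_class 2%N) m| + #|mixed_pairs m|.*2 = p1 + p2)%N.
Proof.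
move=> mP; have dI : [disjoint inner (label_class 1%N) m & inner (label_class 2%N) m].
  apply: disjointW label_disjoint; by apply/subsetP => y; rewrite inE => /andP[].
have -> : (p1 + p2 = #|T|)%N by rewrite card_sum !card_ord.
rewrite -(cardsC (inner (label_class 1%N) m :|: inner (label_class 2%N) m)).
rewrite cardsU disjoint_setI0 // cards0 subn0; congr (_ + _)%N.
apply/esym; rewrite -muln2; apply: (sub_pairs_card mP).
  by apply/subsetP => B; rewrite inE => /andP[].
have mm y : m (m y) = y by have /forallP/(_ y)/andP[_ /eqP] := mP.
have lE y : (y \in ~: (inner (label_class 1%N) m :|: inner (label_class 2%N) m)) = (label y != label (m y)).
  by rewrite !inE; case: y => j; case: (m _) => k.
apply/setP => y; rewrite lE; apply/bigcupP/idP => [[B]|ly].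
  rewrite inE => /andP[/imsetP[z _ ->] /exists_inP[a aB /exists_inP[b bB lab]]].
  have {aB bB lab} lz : label z != label (m z).
    move: aB bB lab; rewrite !inE => /orP[]/eqP-> /orP[]/eqP->; rewrite ?eqxx //.
    by rewrite eq_sym.
  by rewrite !inE => /orP[]/eqP->; rewrite ?mm // eq_sym.
exists [set y; m y]; last by rewrite !inE eqxx.
rewrite inE mem_pairs /=; apply/exists_inP; exists y; first by rewrite !inE eqxx.
by apply/exists_inP; exists (m y); rewrite // !inE eqxx orbT.
Qed.

Definition gamma1_fun (z : T) : T :=
  match z with inl i => inl (ordS i) | inr i => inr i end.
Definition gamma2_fun (z : T) : T :=
  match z with inl i => inl i | inr i => inr (ordS i) end.

Lemma gamma1_inj : injective gamma1_fun.
Proof.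
by move=> [i|i] [j|j] //= [eq_ij]; congr (_ _); apply/ordS_inj/val_inj.
Qed.
Lemma gamma2_inj : injective gamma2_fun.
Proof.
by move=> [i|i] [j|j] //= [eq_ij]; congr (_ _); apply/ordS_inj/val_inj.
Qed.

Definition gamma1 : {perm T} := perm gamma1_inj.
Definition gamma2 : {perm T} := perm gamma2_inj.

Lemma gammaE : gamma p1 p2 = (gamma1 * gamma2)%g.
Proof. by apply/permP => -[j|j]; rewrite permM !permE. Qed.

Lemma gamma1_cyclic : (0 < p1)%N -> cyclic_on (label_class 1%N) gamma1.
Proof.
move=> p0; pose z0 : T := inl (Ordinal p0).
have z0R : z0 \in label_class 1%N by rewrite inE.
have gR : perm_on (label_class 1%N) gamma1.
  by apply/subsetP => -[j|j]; rewrite unfold_in !inE // permE eqxx.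
apply/(cyclic_onP _ z0R); split => //; apply/setP => -[j|j]; rewrite !inE /=.
  apply/porbitP; exists (val j); case: j => j lj /=.
  elim: j lj => [|j IH] lj; first by rewrite perm1; congr inl; apply: val_inj.
  rewrite expgSr permM -(IH (ltnW lj)) permE /=; congr inl; apply: val_inj => /=.
  by rewrite modn_small.
apply/negP => /porbitP[i Ei].
have : (gamma1 ^+ i)%g z0 \in label_class 1%N.
  rewrite perm_closed //; elim: {Ei}i => [|i IH]; first by rewrite expg0 perm_on1.
  by rewrite expgS perm_onM.
by rewrite -Ei inE.
Qed.

Lemma gamma2_cyclic : (0 < p2)%N -> cyclic_on (label_class 2%N) gamma2.
Proof.
move=> p0; pose z0 : T := inr (Ordinal p0).
have z0R : z0 \in label_class 2%N by rewrite inE.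
have gR : perm_on (label_class 2%N) gamma2.
  by apply/subsetP => -[j|j]; rewrite unfold_in !inE // permE eqxx.
apply/(cyclic_onP _ z0R); split => //; apply/setP => -[j|j]; rewrite !inE /=.
  apply/negP => /porbitP[i Ei].
  have : (gamma2 ^+ i)%g z0 \in label_class 2%N.
    rewrite perm_closed //; elim: {Ei}i => [|i IH]; first by rewrite expg0 perm_on1.
    by rewrite expgS perm_onM.
  by rewrite -Ei inE.
apply/porbitP; exists (val j); case: j => j lj /=.
elim: j lj => [|j IH] lj; first by rewrite perm1; congr inr; apply: val_inj.
rewrite expgSr permM -(IH (ltnW lj)) permE /=; congr inr; apply: val_inj => /=.
by rewrite modn_small.
Qed.

End Annulus.

Lemma cyclic_onV (T : finType) (R : {set T}) (s : {perm T}) :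
  cyclic_on R s -> cyclic_on R s^-1%g.
Proof. by rewrite /cyclic_on porbitsV => /andP[/perm_onV ->]. Qed.

(** [pairings] counts non-mixed pairs by the points they cover; as all pairs together cover p1 + p2
    points, s mixed pairs remain. *)
Lemma pairing_setE (q1 q2 s : nat) :
  pairing_set q1 q2 s = pairings (label_class _ _ 1%N) (label_class _ _ 2%N) q1 q2.
Proof.
apply/setP => m; rewrite !inE -is_pairingE; case mP: (is_pairing m) => //=.
have := card_mixed mP; rewrite !card_nonmixed // !(inj_eq double_inj).
case: eqP => //= ->; case: eqP => //= -> E; apply/eqP.
have {E} : (#|mixed_pairs m|.*2 = s.*2)%N by rewrite -!mul2n in E *; lia.
exact: double_inj.
Qed.

Lemma pairing_on_fixed_rows (T : finType) (A B : {set T}) q1 q2 (m h : {perm T}) :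
  h @: A = A -> h @: B = B ->
  ((m ^ h)%g \in pairings A B q1 q2) = (m \in pairings A B q1 q2).
Proof.
move=> hA hB; have innerJ (C : {set T}) : h @: C = C -> inner C (m ^ h)%g = h @: inner C m.
  move=> hC; apply/setP => y; rewrite -(permKV h y) mem_imset; last exact: perm_inj.
  by rewrite !inE permJ -{1 2}hC !mem_imset //; exact: perm_inj.
have hAB : h @: (A :|: B) = A :|: B by rewrite imsetU hA hB.
rewrite !inE !innerJ // !card_imset; try exact: perm_inj.
congr (_ && _); rewrite /pairing_on -{1}hAB perm_onJ; congr (_ && _).
apply/forall_inP/forall_inP => mP y yS.
  have := mP (h y); rewrite -{1}hAB imset_f // => /(_ isT).
  by rewrite !permJ !(inj_eq perm_inj).
rewrite -(permKV h y) !permJ !(inj_eq perm_inj); apply: mP.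
by rewrite -(mem_imset _ _ (@perm_inj _ h)) hAB permKV.
Qed.

Lemma gen_series_horner (q1 q2 s : nat) (x : rat) : (0 < s)%N ->
  (gen_series q1 q2 s).[x] =
  \sum_(m in pairing_set q1 q2 s)
     cycw x ((gamma (2 * q1 + s) (2 * q2 + s))^-1 * m)%g.
Proof.
move=> s0; rewrite /gen_series horner_sum.
set p := ((2 * q1 + s) + (2 * q2 + s))%N.
set c := fun m => #|porbits ((gamma (2 * q1 + s) (2 * q2 + s))^-1 * m)%g|.
have c_le m : (0 < c m < p.+1)%N.
  rewrite ltnS; apply/andP; split; last first.
    by rewrite (leq_trans (leq_imset_card _ _)) // card_sum !card_ord.
  have p0 : (0 < 2 * q1 + s)%N by rewrite addn_gt0 s0 orbT.
  by apply/card_gt0P; exists (porbit ((gamma _ _)^-1 * m)%g (inl (Ordinal p0))); apply/imsetP; exists (inl (Ordinal p0)).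
rewrite (eq_bigr (fun L => \sum_(m in pairing_set q1 q2 s) if c m == L then x ^+ L else 0)); last first.
  move=> L _; rewrite hornerZ hornerXn /coef_a -big_mkcondr /= sumr_const mulr_natl.
  by congr (_ *+ _); apply: eq_card => m; rewrite [LHS]inE.
rewrite exchange_big /=; apply: eq_bigr => m _.
rewrite (bigD1_seq (c m)) ?mem_index_iota ?c_le ?iota_uniq //= eqxx big1 ?addr0 //.
by move=> L /negbTE; rewrite eq_sym => ->.
Qed.

(** * Averaging over the cycles of both rows *)

Section Assembly.
Variables (T : finType) (x : rat).
Hypothesis x0 : x != 0.
Implicit Types (A B : {set T}) (m s h : {perm T}).

Definition hook_total n q1 q2 : rat :=
  \sum_(b < n.+1) pair_iter x n q1 altsgn b * pair_iter x n q2 altsgn b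
     * (rise x (n - b) * fall x b).

(** As |A| > 2 q1, some point of [A] lies on a mixed pair and serves as root. Each cycle sum then
    becomes an alternating hook sum at the price of the factor |A| or |B|. The value is the same for
    every [m]. *)
Lemma cycle_sum_pairing A B m n q1 q2 : [disjoint A & B] -> A :|: B = setT ->
  #|A| = (q1.*2 + n.+1)%N -> #|B| = (q2.*2 + n.+1)%N -> m \in pairings A B q1 q2 ->
  #|A|%:R * #|B|%:R * cycle_sum A (fun s => cycle_sum B (fun t => cycw x (s * t * m)%g)) =
  (n.+1)`!%:R * hook_total n q1 q2 * x.
Proof.
move=> dAB AB cA cB; rewrite inE => /and3P[mP /eqP iA /eqP iB].
have mK := pairing_onK mP.
have [z zA mzA] : exists2 z, z \in A & m z \notin A.
  have /subsetPn[z zA] : ~~ (A \subset inner A m).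
    by apply/negP => /subset_leq_card; rewrite iA cA addnS ltnNge leq_addr.
  by rewrite inE zA => mz; exists z.
have inB y : y \notin A -> y \in B.
  by move=> yA; have := in_setT y; rewrite -AB inE (negbTE yA).
have mzB := inB _ mzA.
have BNA y : y \in B -> y \notin A by move=> yB; rewrite (disjointFl dAB).
have mJ y : m y = z -> y = m z by move=> <-; rewrite mK.
have Hr : two_rows z (A :\ z) (m z) (B :\ m z) m n q1 q2.
  split; split; rewrite ?setD11 ?setD1K //.
  - by move: cA; rewrite (cardsD1 z) zA add1n addnS addnC => -[->].
  - by move: cB; rewrite (cardsD1 (m z)) mzB add1n addnS addnC => -[->].
  - rewrite -iA; apply: eq_card => y; rewrite !inE.
    have [->|yz] := eqVneq y z; first by rewrite (negbTE mzA) !andbF.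
    have [/mJ ->|_] := eqVneq (m y) z; last by [].
    by rewrite (negbTE mzA) /= ?andbF.
  - rewrite -iB; apply: eq_card => y; rewrite !inE (inj_eq perm_inj).
    have [->|yz] := eqVneq y z; first by rewrite (negbTE (contraL (BNA z) zA)) ?andbF.
    have [->|//] := eqVneq y (m z).
    by rewrite mK (negbTE (contraL (BNA z) zA)) ?andbF.
have := row_sumE x0 altsgn altsgn Hr.
rewrite /row_sum hook_comb_cycles ?setD11 // setD1K // /row_value.
have -> : cycle_sum A (fun s => hook_comb (m z) (B :\ m z) altsgn 1%g (fun t => cycw x (s * t * m)%g)) =
   #|B|%:R * cycle_sum A (fun s => cycle_sum B (fun t => cycw x (s * t * m)%g)).
  rewrite mulr_sumr; apply: eq_bigr => s _.
  by rewrite hook_comb_cycles ?setD11 // setD1K.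
rewrite mulrA -/(hook_total n q1 q2).
(* There are |A| + |B| points, one more than the exponent on the left; hence the single factor x. *)
have -> : cycw x (1 : {perm T})%g = x ^+ (q1.*2 + q2.*2 + n.*2.+1) * x.
  rewrite /cycw -exprSr; congr (_ ^+ _).
  have := @card_porbits_on T set0 1%g (perm_on1 _); rewrite imset0 !cards0 !addn0 => ->.
  rewrite -cardsT -AB cardsU disjoint_setI0 // cards0 cA cB; lia.
rewrite mulrA => E; apply: (mulfI (expf_neq0 (q1.*2 + q2.*2 + n.*2.+1) x0)).
by rewrite mulrA mulrA E; ring.
Qed.

Lemma eq_cycle_sum A F G : (forall s, perm_on A s -> F s = G s) -> cycle_sum A F = cycle_sum A G.
Proof. by move=> FG; apply: eq_bigr => s /andP[/FG]. Qed.

Lemma perm_on_imset_disjoint A B h : [disjoint A & B] -> perm_on A h -> h @: B = B.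
Proof.
move=> dAB hA; rewrite -[RHS]imset_id; apply: eq_in_imset => y yB.
by rewrite (out_perm hA) // (disjointFl dAB).
Qed.

(** Conjugation by a permutation of one row preserves the set of pairings and fixes the cycle of the
    other row, so the sum over [m] depends only on the conjugacy class of each cycle; a row of p
    points has (p-1)! full cycles. *)
Lemma sum_pairings A B q1 q2 d1 d2 : [disjoint A & B] -> A != set0 -> B != set0 ->
  cyclic_on A d1 -> cyclic_on B d2 ->
  \sum_(m in pairings A B q1 q2) cycle_sum A (fun s => cycle_sum B (fun t => cycw x (s * t * m)%g)) =
  (#|A|.-1)`!%:R * (#|B|.-1)`!%:R * \sum_(m in pairings A B q1 q2) cycw x (d1 * d2 * m)%g.
Proof.
move=> dAB A0 B0 d1C d2C.
pose F (s t : {perm T}) := \sum_(m in pairings A B q1 q2) cycw x (s * t * m)%g.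
have dBA : [disjoint B & A] by rewrite disjoint_sym.
have FJ s t h : h @: A = A -> h @: B = B -> F (s ^ h)%g (t ^ h)%g = F s t.
  move=> hA hB; rewrite /F [LHS](reindex_inj (conjg_inj h)) /=; apply: eq_big => [m|m _].
    by rewrite pairing_on_fixed_rows.
  by rewrite -!conjMg cycwJ.
have JE (C D : {set T}) s h : [disjoint C & D] -> perm_on C s -> perm_on D h -> (s ^ h = s)%g.
  by move=> CD sC hD; apply/conjg_fixP/commgP; exact: perm_on_comm CD sC hD.
transitivity (cycle_sum A (fun s => cycle_sum B (F s))).
  by rewrite exchange_big /=; apply: eq_bigr => s _; rewrite exchange_big.
transitivity (cycle_sum A (fun s => (#|B|.-1)`!%:R * F s d2)).
  apply: eq_cycle_sum => s sA; apply: cycle_sum_invariant => // t h hB.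
  rewrite -{1}(JE _ _ _ _ dAB sA hB).
  by apply: FJ; [exact: perm_on_imset_disjoint dBA hB | exact: im_perm_on].
have [d1A _] := andP d1C; have [d2B _] := andP d2C.
rewrite (cycle_sum_invariant A0 d1C) ?mulrA // => t h hA; congr (_ * _).
rewrite -{1}(JE _ _ _ _ dBA d2B hA).
by apply: FJ; [exact: im_perm_on | exact: perm_on_imset_disjoint dAB hA].
Qed.
End Assembly.

(** Row lengths and numbers of cycles combine to p1! p2!, which cancels against the number p1! p2! /
    (q1! q2! 2^(q1+q2) s!) of pairings; its s! cancels the one in [cycle_sum_pairing]. *)
Lemma gen_series_hook (q1 q2 s : nat) (x : rat) : (0 < s)%N -> x != 0 ->
  (gen_series q1 q2 s).[x] * (q1`! * q2`! * 2 ^ (q1 + q2))%:R = hook_total x s.-1 q1 q2 * x.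
Proof.
move=> s0 x0; rewrite gen_series_horner // pairing_setE.
set p1 := (2 * q1 + s)%N; set p2 := (2 * q2 + s)%N.
have p10 : (0 < p1)%N by rewrite addn_gt0 s0 orbT.
have p20 : (0 < p2)%N by rewrite addn_gt0 s0 orbT.
set A := label_class p1 p2 1%N; set B := label_class p1 p2 2%N.
have dAB : [disjoint A & B] := label_disjoint p1 p2.
have AB : A :|: B = setT := label_cover p1 p2.
have cA : #|A| = p1 := card_label1 p1 p2.
have cB : #|B| = p2 := card_label2 p1 p2.
have A0 : A != set0 by rewrite -cards_eq0 cA -lt0n.
have B0 : B != set0 by rewrite -cards_eq0 cB -lt0n.
have g1C := cyclic_onV (gamma1_cyclic p2 p10).
have g2C := cyclic_onV (gamma2_cyclic p1 p20).
have gE : ((gamma p1 p2)^-1 = (gamma1 p1 p2)^-1 * (gamma2 p1 p2)^-1)%g.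
  have [g1P _] := andP g1C; have [g2P _] := andP g2C.
  by rewrite gammaE invMg (perm_on_comm dAB g1P g2P).
rewrite gE; set S := \sum_(m in _) _.
have cA' : #|A| = (q1.*2 + s.-1.+1)%N by rewrite cA prednK // /p1 mul2n.
have cB' : #|B| = (q2.*2 + s.-1.+1)%N by rewrite cB prednK // /p2 mul2n.
have E1 : p1%:R * p2%:R * ((p1.-1)`!%:R * (p2.-1)`!%:R * S) =
    #|pairings A B q1 q2|%:R * (s`!%:R * hook_total x s.-1 q1 q2 * x).
  have := sum_pairings x q1 q2 dAB A0 B0 g1C g2C; rewrite cA cB -/S => <-.
  rewrite mulr_sumr.
  rewrite (eq_bigr (fun=> s`!%:R * hook_total x s.-1 q1 q2 * x)).
    by rewrite sumr_const [RHS]mulr_natl.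
  move=> m mP; have := cycle_sum_pairing x0 dAB AB cA' cB' mP.
  by rewrite prednK // cA cB.
have E2 : #|pairings A B q1 q2|%:R * ((q1`! * q2`! * 2 ^ (q1 + q2))%:R * s`!%:R) =
    p1`!%:R * p2`!%:R :> rat.
  rewrite prednK // in cA' cB'.
  by rewrite -!natrM (card_pairings dAB cA' cB') /p1 /p2 !mul2n.
have f0 n : n`!%:R != 0 :> rat by rewrite pnatr_eq0 -lt0n fact_gt0.
have fE p : (0 < p)%N -> p`!%:R = p%:R * (p.-1)`!%:R :> rat.
  by case: p => // p _; rewrite factS natrM.
apply: (mulfI (f0 p1)); apply: (mulfI (f0 p2)).
transitivity ((p1%:R * p2%:R * ((p1.-1)`!%:R * (p2.-1)`!%:R * S)) *
   (q1`! * q2`! * 2 ^ (q1 + q2))%:R).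
  by rewrite (fE p1 p10) (fE p2 p20); ring.
rewrite E1; transitivity ((p1`!%:R * p2`!%:R) * (hook_total x s.-1 q1 q2 * x)); last by ring.
by rewrite -E2; ring.
Qed.

(** * Coefficient identities *)

Definition hpoly (e M : nat) : {poly rat} := (1 + 'X) ^+ M * (1 + 2^-1 *: 'X) ^+ e.
(** h_i(M) is the case r = q_i + s, e = q_i; the general form is used by [hcoef_sym]. *)
Definition hcoef (r e M : nat) : rat := (hpoly e M)`_r.

Lemma coef_1DZX (R : comNzRingType) (c : R) e k :
  ((1 + c *: 'X : {poly R}) ^+ e)`_k = 'C(e, k)%:R * c ^+ k.
Proof.
rewrite exprDn coef_sum.
under eq_bigr => i _ do rewrite expr1n mul1r exprZn coefMn coefZ coefXn.
have [ke|ke] := ltnP k e.+1; last first.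
  rewrite bin_small // mul0r big1 // => i _.
  by rewrite gtn_eqF ?mulr0 ?mul0rn // (leq_trans (ltn_ord i)).
rewrite (bigD1 (Ordinal ke)) //= eqxx mulr1 mulr_natl big1 ?addr0 // => i.
by rewrite -val_eqE /= eq_sym => /negbTE ->; rewrite mulr0 mul0rn.
Qed.

Lemma coef_1DX M k : ((1 + 'X : {poly rat}) ^+ M)`_k = 'C(M, k)%:R.
Proof. by rewrite -['X]scale1r coef_1DZX expr1n mulr1. Qed.

Lemma hcoefE r e M :
  hcoef r e M = \sum_(j < r.+1) 'C(e, j)%:R * 2^-1 ^+ j * 'C(M, r - j)%:R.
Proof.
rewrite /hcoef /hpoly (mulrC (_ ^+ M)) coefM; apply: eq_bigr => j _ /=.
by rewrite coef_1DZX coef_1DX.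
Qed.

Lemma ffactnD n a b : (n ^_ (a + b) = n ^_ a * (n - a) ^_ b)%N.
Proof.
elim: b => [|b IH]; first by rewrite addn0 ffactn0 muln1.
by rewrite addnS !ffactnSr IH subnDA mulnA.
Qed.

(** The identity holds term by term in the power w^j taken from the factor in 1 + w/2: both sides
    are the same quotient of factorials. For j > q the left-hand terms vanish through C(q, j). *)
Lemma hcoef_sym q s N : (s <= N)%N ->
  (q + s)`!%:R * hcoef (q + s) q N = q`!%:R * ((N ^_ s)%:R * hcoef q (q + s) (N - s)).
Proof.
move=> sN; rewrite !hcoefE -addSn.
rewrite (big_ord_widen_cond _ predT (fun j => 'C(q + s, j)%:R * 2^-1 ^+ j * 'C(N - s, q - j)%:R) (leq_addr s q.+1)).
rewrite [in RHS]big_mkcond /= !mulr_sumr; apply: eq_bigr => j _.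
case: ltnP => jq; last by rewrite bin_small // !mul0r !mulr0.
rewrite ltnS in jq.
have f0 n : n`!%:R != 0 :> rat by rewrite pnatr_eq0 -lt0n fact_gt0.
have E : ((q + s)`! * ('C(q, j) * 'C(N, q + s - j)) =
          q`! * (N ^_ s * ('C(q + s, j) * 'C(N - s, q - j))))%N.
  apply/eqP; rewrite -(eqn_pmul2r (fact_gt0 (q - j))) -(eqn_pmul2r (fact_gt0 (q + s - j))).
  rewrite -(eqn_pmul2r (fact_gt0 j)); apply/eqP.
  have E1 := bin_fact jq; have E2 := @bin_fact (q + s) j (leq_trans jq (leq_addr s q)).
  have E3 := bin_ffact N (q + s - j); have E4 := bin_ffact (N - s) (q - j).
  have E5 : (N ^_ (q + s - j) = N ^_ s * (N - s) ^_ (q - j))%N.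
    by rewrite (addnC q) -addnBA // ffactnD.
  transitivity ((q + s)`! * ('C(q, j) * (j`! * (q - j)`!)) * ('C(N, q + s - j) * (q + s - j)`!))%N; first ring.
  rewrite E1 E3 E5 -E2 -E4; ring.
have := congr1 (fun n => n%:R : rat) E; rewrite !natrM => E'.
transitivity (2^-1 ^+ j * ((q + s)`!%:R * ('C(q, j)%:R * 'C(N, q + s - j)%:R)) : rat); first ring.
by rewrite E'; ring.
Qed.

(** The left side is the coefficient of w^(2q+s) in (1+w)^M ((1+w)^2 - 1)^q. *)
Lemma altsum_hcoef q s M :
  \sum_(j < q.+1) 'C(q, j)%:R * (-1) ^+ j * 'C(M + (q - j).*2, q.*2 + s)%:R =
  2 ^+ q * hcoef (q + s) q M :> rat.
Proof.
have E : \sum_(j < q.+1) ('C(q, j)%:R * (-1) ^+ j) *: (1 + 'X) ^+ (M + (q - j).*2)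
   = 2 ^+ q *: ('X^q * hpoly q M) :> {poly rat}.
  transitivity ((1 + 'X) ^+ M * ((1 + 'X) ^+ 2 - 1) ^+ q : {poly rat}).
    rewrite exprBn mulr_sumr; apply: eq_bigr => j _.
    rewrite expr1n mulr1 exprD -exprM mul2n -mul_polyC polyCM rmorphXn rmorphN1 polyC_natr /=.
    by rewrite -mulr_natl; ring.
  have -> : ((1 + 'X) ^+ 2 - 1 = 2 *: ('X * (1 + 2^-1 *: 'X)) :> {poly rat}).
    rewrite -!mul_polyC mulrDr mulrDr !mulrA [_%:P * 'X * _%:P]mulrAC -polyCM divff // polyC_natr.
    ring.
  by rewrite exprZn exprMn /hpoly -scalerAr mulrCA.
have := congr1 (fun p : {poly rat} => p`_(q.*2 + s)) E.
rewrite coef_sum coefZ coefXnM => E'.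
have -> : \sum_(j < q.+1) 'C(q, j)%:R * (-1) ^+ j * 'C(M + (q - j).*2, q.*2 + s)%:R =
  2 ^+ q * (if (q.*2 + s < q)%N then 0 else (hpoly q M)`_(q.*2 + s - q)).
  by rewrite -E'; apply: eq_bigr => j _; rewrite coefZ coef_1DX.
rewrite ltnNge -addnn -addnA leq_addr /= /hcoef; congr (_ * _`_ _).
by rewrite addKn.
Qed.

(** A bound common to all exponents makes double sums rectangular; the surplus terms carry a zero
    binomial. *)
Lemma exprDn_wide (R : comNzRingType) (x y : R) k K : (k <= K)%N ->
  (x + y) ^+ k = \sum_(a < K.+1) 'C(k, a)%:R * (x ^+ (k - a) * y ^+ a).
Proof.
move=> kK; rewrite exprDn.
rewrite (big_ord_widen K.+1 (fun a => (x ^+ (k - a) * y ^+ a) *+ 'C(k, a))) // big_mkcond.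
apply: eq_bigr => a _; case: ltnP => ak; first by rewrite mulr_natl.
by rewrite bin_small // mul0r.
Qed.

Definition coef2 (r1 r2 : nat) (f : {poly {poly rat}}) : rat := (f`_r1)`_r2.

Lemma coef2_sum r1 r2 (I : finType) (f : I -> {poly {poly rat}}) :
  coef2 r1 r2 (\sum_i f i) = \sum_i coef2 r1 r2 (f i).
Proof. by rewrite /coef2 !coef_sum. Qed.

Lemma coef2_natM r1 r2 n f : coef2 r1 r2 (n%:R * f) = n%:R * coef2 r1 r2 f.
Proof. by rewrite /coef2 !mulr_natl !coefMn. Qed.

Lemma coef2_split r1 r2 (p q : {poly rat}) :
  coef2 r1 r2 (p^:P * q%:P) = p`_r1 * q`_r2.
Proof. by rewrite /coef2 coefMC coef_map coefCM. Qed.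

Lemma coef_XnM_1DhX r e a :
  ('X^a * (1 + 2^-1 *: 'X : {poly rat}) ^+ e)`_r =
  if (a < r.+1)%N then 'C(e, r - a)%:R * 2^-1 ^+ (r - a) else 0.
Proof.
rewrite coefXnM ltnS [in RHS]leqNgt; case: (ltnP r a) => ra //=.
exact: coef_1DZX.
Qed.

(* With w = 'X and v = 'X%:P, the left-hand side is a coefficient of a product
   containing ((1 + w)(1 + v))^M = (1 + v(1 + w/2) + w(1 + v/2))^M. *)
Lemma hcoef_mul_aux r1 e1 r2 e2 M :
  hcoef r1 e1 M * hcoef r2 e2 M =
  \sum_(a2 < r2.+1) \sum_(a1 < r1.+1)
    'C(M, a2)%:R * 'C(M - a2, a1)%:R *
    ('C(e1 + a2, r1 - a1)%:R * 2^-1 ^+ (r1 - a1) *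
     ('C(e2 + a1, r2 - a2)%:R * 2^-1 ^+ (r2 - a2))).
Proof.
pose K := (M + r1 + r2)%N.
pose l : {poly rat} := 1 + 2^-1 *: 'X.
rewrite -coef2_split.
have MK : (M <= K)%N by rewrite /K -addnA leq_addr.
have -> : (hpoly e1 M)^:P * (hpoly e2 M)%:P =
  \sum_(a2 < K.+1) \sum_(a1 < K.+1) 'C(M, a2)%:R * ('C(M - a2, a1)%:R *
     (('X^a1 * l ^+ (e1 + a2))^:P * ('X^a2 * l ^+ (e2 + a1))%:P)).
  transitivity ((((1 + 'X) * (1 + 'X%:P)) ^+ M) * ((l^:P) ^+ e1 * (l%:P) ^+ e2)).
    rewrite /hpoly !rmorphM !rmorphXn /= rmorphD rmorph1 /= map_polyX -/l.
    by rewrite polyCD polyC1 exprMn; ring.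
  have -> : (1 + 'X) * (1 + 'X%:P) = 1 + 'X%:P * l^:P + 'X * l%:P.
    rewrite /l rmorphD rmorph1 /= map_polyZ map_polyX polyCD polyC1 /=.
    have cc : (2^-1)%:P%:P + (2^-1)%:P%:P = 1 :> {poly {poly rat}}.
      have hh : 2^-1 + 2^-1 = 1 :> rat by lra.
      by rewrite -!polyCD hh !polyC1.
    rewrite -!mul_polyC polyCM; move: cc; set c := _%:P%:P => cc.
    transitivity (1 + 'X + 'X%:P + (c + c) * ('X * 'X%:P) : {poly {poly rat}}); last by ring.
    by rewrite cc; ring.
  rewrite addrAC (exprDn_wide _ _ MK) mulr_suml; apply: eq_bigr => a2 _.
  have MK2 : (M - a2 <= K)%N := leq_trans (leq_subr _ _) MK.
  rewrite (exprDn_wide _ _ MK2) mulr_suml mulr_sumr mulr_suml; apply: eq_bigr => a1 _.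
  rewrite expr1n mul1r !exprMn !exprD !rmorphM !rmorphXn /= map_polyX.
  ring.
have r1K : (r1.+1 <= K.+1)%N by rewrite ltnS /K addnAC leq_addl.
have r2K : (r2.+1 <= K.+1)%N by rewrite ltnS /K leq_addl.
rewrite coef2_sum [RHS](big_ord_widen K.+1 (fun a2 => \sum_(a1 < r1.+1)
    'C(M, a2)%:R * 'C(M - a2, a1)%:R *
    ('C(e1 + a2, r1 - a1)%:R * 2^-1 ^+ (r1 - a1) *
     ('C(e2 + a1, r2 - a2)%:R * 2^-1 ^+ (r2 - a2))))) // [in RHS]big_mkcond.
apply: eq_bigr => a2 _; rewrite coef2_sum.
rewrite (big_ord_widen K.+1 (fun a1 => 
    'C(M, a2)%:R * 'C(M - a2, a1)%:R *
    ('C(e1 + a2, r1 - a1)%:R * 2^-1 ^+ (r1 - a1) *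
     ('C(e2 + a1, r2 - a2)%:R * 2^-1 ^+ (r2 - a2))))) // [in RHS]big_mkcond.
case: (ltnP a2 r2.+1) => ar2; last first.
  rewrite big1 // => a1 _; rewrite !coef2_natM coef2_split !coef_XnM_1DhX.
  by rewrite (leq_gtF ar2) !mulr0.
apply: eq_bigr => a1 _; rewrite !coef2_natM coef2_split !coef_XnM_1DhX ar2.
by case: ifP => _; rewrite ?mul0r ?mulr0 // mulrA.
Qed.

Lemma factr_neq0 n : n`!%:R != 0 :> rat.
Proof. by rewrite pnatr_eq0 -lt0n fact_gt0. Qed.

(** With t_i = r_i - a_i the exponents of [hcoef_mul_aux] become the summation indices of the
    formula. *)
Lemma hcoef_mul r1 e1 r2 e2 M :
  hcoef r1 e1 M * hcoef r2 e2 M =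
  \sum_(t1 < r1.+1) \sum_(t2 < r2.+1)
    (M ^_ ((r1 - t1) + (r2 - t2)))%:R / ((r1 - t1)`!%:R * (r2 - t2)`!%:R)
    * ('C(e1 + (r2 - t2), t1)%:R * 'C(e2 + (r1 - t1), t2)%:R) * 2^-1 ^+ (t1 + t2).
Proof.
rewrite hcoef_mul_aux exchange_big (reindex_inj rev_ord_inj) /=; apply: eq_bigr => t1 _.
rewrite (reindex_inj rev_ord_inj) /=; apply: eq_bigr => t2 _.
have lt1 : (t1 <= r1)%N by rewrite -ltnS. have lt2 : (t2 <= r2)%N by rewrite -ltnS.
rewrite !subSS !subKn // exprD.
have -> : 'C(M, r2 - t2)%:R * 'C(M - (r2 - t2), r1 - t1)%:R =
  (M ^_ ((r1 - t1) + (r2 - t2)))%:R / ((r1 - t1)`!%:R * (r2 - t2)`!%:R) :> rat.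
  apply: (canRL (mulfK _)); first by rewrite mulf_neq0 ?factr_neq0.
  rewrite addnC ffactnD -!bin_ffact !natrM; ring.
ring.
Qed.

Lemma inv_fact_sub (a b : nat) :
  inv_fact (a%:Z - b%:Z) = if (b <= a)%N then ((a - b)`!%:R)^-1 else 0.
Proof.
case: leqP => ab; first by rewrite subzn.
have -> : a%:Z - b%:Z = Negz (b - a).-1 by lia.
by [].
Qed.

Lemma horner_binom_poly k (N : nat) : (binom_poly k).[N%:R] = 'C(N, k)%:R.
Proof.
rewrite /binom_poly hornerZ horner_prod.
have -> : \prod_(i < k) ('X - (i%:R)%:P : {poly rat}).[N%:R] = (N ^_ k)%:R.
  elim: k => [|k IH]; first by rewrite big_ord0.
  rewrite big_ord_recr /= IH hornerXsubC ffactnSr natrM.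
  have [kN|Nk] := leqP k N; first by rewrite natrB.
  by rewrite ffact_small // !mul0r.
by rewrite -bin_ffact natrM mulrC mulfK ?factr_neq0.
Qed.

(** * The two halves of the formula as antidifferences *)

Section Target.
Variables q1 q2 s : nat.
Local Notation d := (q1 + q2 + s)%N.
Local Notation p1 := (2 * q1 + s)%N.
Local Notation p2 := (2 * q2 + s)%N.

Definition coef_common (t1 t2 : nat) : rat :=
  (d - t1)`!%:R * (d - t2)`!%:R * p1`!%:R * p2`!%:R
     / (2 ^+ (t1 + t2) * t1`!%:R * t2`!%:R) * inv_fact (d%:Z - t1%:Z - t2%:Z).

Definition coef_first (t1 t2 : nat) : rat :=
  inv_fact q1 * inv_fact q2
     * inv_fact (s%:Z + q1%:Z - t1%:Z) * inv_fact (s%:Z + q2%:Z - t2%:Z).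

Definition coef_second (t1 t2 : nat) : rat :=
  inv_fact (q1%:Z + s%:Z) * inv_fact (q2%:Z + s%:Z)
     * inv_fact (q1%:Z - t1%:Z) * inv_fact (q2%:Z - t2%:Z).

(** For e = 1 this is one half of the formula at x = N; by Pascal's rule e = 0 gives its forward
    difference. *)
Definition binsum (c : nat -> nat -> rat) (e N : nat) : rat :=
  \sum_(t1 < (q1 + s).+1) \sum_(t2 < (q2 + s).+1)
     coef_common t1 t2 * c t1 t2 * 'C(N, d - t1 - t2 + e)%:R.

Lemma binsumS c N : binsum c 1 N.+1 = binsum c 1 N + binsum c 0 N.
Proof.
rewrite -big_split; apply: eq_bigr => t1 _; rewrite -big_split; apply: eq_bigr => t2 _ /=.
by rewrite addn1 addn0 binS natrD mulrDr.
Qed.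

Lemma binsum0 c : binsum c 1 0 = 0.
Proof.
rewrite /binsum big1 // => t1 _; rewrite big1 // => t2 _.
by rewrite addn1 bin0n mulr0.
Qed.

(* For [M < s] the denominator is 0, hence so is the quotient; this agrees with
   the vanishing of the corresponding polynomial at M = 0, ..., s - 1. *)
Definition window_term (M : nat) : rat :=
  p1`!%:R * p2`!%:R / (q1`!%:R * q2`!%:R) * (hcoef (q1 + s) q1 M * hcoef (q2 + s) q2 M)
    / (M ^_ s)%:R.

Lemma coef_common_bin t1 t2 :
  coef_common t1 t2 = p1`!%:R * p2`!%:R * (d - t1 - t2)`!%:R
     * ('C(d - t2, t1)%:R * 'C(d - t1, t2)%:R) * 2^-1 ^+ (t1 + t2).
Proof.
have -> : coef_common t1 t2 = (d - t1)`!%:R * (d - t2)`!%:R * p1`!%:R * p2`!%:R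
     / (2 ^+ (t1 + t2) * t1`!%:R * t2`!%:R) * inv_fact (d%:Z - (t1 + t2)%:Z).
  by rewrite /coef_common (PoszD t1) opprD addrA.
rewrite inv_fact_sub; case: leqP => td; last first.
  (* For t1 + t2 > d the left side is 0 by [inv_fact], and one of the two binomials on the right
     vanishes. *)
  rewrite mulr0; case: (leqP t2 d) => h2; last first.
    by rewrite (@bin_small (d - t1)) ?mul0r ?mulr0 ?mul0r //; lia.
  by rewrite (@bin_small (d - t2)) ?mul0r ?mulr0 ?mul0r //; lia.
have t1d : (t1 <= d - t2)%N by lia.
have t2d : (t2 <= d - t1)%N by lia.
rewrite -(bin_fact t1d) -(bin_fact t2d) subnDA.
have -> : (d - t2 - t1 = d - t1 - t2)%N by lia.
rewrite !natrM exprVn; field.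
by rewrite !factr_neq0 expf_neq0.
Qed.

(** With M = N + s and k = d - t1 - t2, the falling factorial of length s + k in [hcoef_mul] splits
    into [M ^_ s], which cancels the denominator of the window term, and [N ^_ k], which is k! C(N,
    k). *)
Lemma binsum_first N : binsum coef_first 0 N = window_term (N + s).
Proof.
have W0 : ((N + s) ^_ s)%:R != 0 :> rat by rewrite pnatr_eq0 -lt0n ffact_gt0 leq_addl.
rewrite /window_term hcoef_mul mulr_sumr mulr_suml; apply: eq_bigr => t1 _.
rewrite mulr_sumr mulr_suml; apply: eq_bigr => t2 _.
have lt1 : (t1 <= q1 + s)%N by rewrite -ltnS.
have lt2 : (t2 <= q2 + s)%N by rewrite -ltnS.
rewrite coef_common_bin addn0.
have -> : (q1 + (q2 + s - t2) = d - t2)%N by lia.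
have -> : (q2 + (q1 + s - t1) = d - t1)%N by lia.
have -> : coef_first t1 t2 = (q1`!%:R * q2`!%:R * ((q1 + s - t1)`!%:R * (q2 + s - t2)`!%:R))^-1.
  rewrite /coef_first -!PoszD !inv_fact_sub (addnC s) (addnC s) lt1 lt2 /=.
  by rewrite !invfM; ring.
have [td|td] := leqP t1 (d - t2); last by rewrite (bin_small td) !(mul0r, mulr0).
have -> : (q1 + s - t1 + (q2 + s - t2) = s + (d - t1 - t2))%N by lia.
rewrite ffactnD addnK natrM -(bin_ffact N) natrM.
by field; rewrite W0 !factr_neq0.
Qed.

Lemma binsum_second_narrow N : binsum coef_second 0 N =
  \sum_(t1 < q1.+1) \sum_(t2 < q2.+1)
     coef_common t1 t2 * coef_second t1 t2 * 'C(N, d - t1 - t2)%:R.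
Proof.
have le1 : (q1.+1 <= (q1 + s).+1)%N by rewrite ltnS leq_addr.
have le2 : (q2.+1 <= (q2 + s).+1)%N by rewrite ltnS leq_addr.
rewrite [RHS](big_ord_widen _ (fun t1 => \sum_(t2 < q2.+1)
     coef_common t1 t2 * coef_second t1 t2 * 'C(N, d - t1 - t2)%:R) le1) [RHS]big_mkcond.
apply: eq_bigr => t1 _.
rewrite (big_ord_widen _ (fun t2 => coef_common t1 t2 * coef_second t1 t2 * 'C(N, d - t1 - t2)%:R) le2).
rewrite [in RHS]big_mkcond ltnS; case: leqP => lt1; last first.
  rewrite big1 // => t2 _.
  by rewrite /coef_second (inv_fact_sub q1) leqNgt lt1 !(mulr0, mul0r).
apply: eq_bigr => t2 _; rewrite ltnS addn0; case: leqP => lt2 //.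
by rewrite /coef_second (inv_fact_sub q2) leqNgt lt2 !(mulr0, mul0r).
Qed.

(** By [hcoef_sym] each h_i(N) supplies a factor [N ^_ s]: one cancels the denominator, the other
    completes a falling factorial of N - s to one of N. For N < s both sides are 0, since d - t1 -
    t2 >= s on the narrow range. *)
Lemma binsum_second N : binsum coef_second 0 N = window_term N.
Proof.
rewrite binsum_second_narrow; have [sN|Ns] := leqP s N; last first.
  rewrite /window_term ffact_small // invr0 mulr0 big1 // => t1 _; rewrite big1 // => t2 _.
  rewrite bin_small ?mulr0 //.
  have := ltn_ord t1; have := ltn_ord t2; lia.
have W0 : (N ^_ s)%:R != 0 :> rat by rewrite pnatr_eq0 -lt0n ffact_gt0.
have hE q : hcoef (q + s) q N = q`!%:R * ((N ^_ s)%:R * hcoef q (q + s) (N - s)) / (q + s)`!%:R.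
  by rewrite -hcoef_sym // mulrC mulKf ?factr_neq0.
transitivity (p1`!%:R * p2`!%:R / ((q1 + s)`!%:R * (q2 + s)`!%:R) * (N ^_ s)%:R
    * (hcoef q1 (q1 + s) (N - s) * hcoef q2 (q2 + s) (N - s))); last first.
  by rewrite /window_term !hE; field; rewrite W0 !factr_neq0.
rewrite hcoef_mul mulr_sumr; apply: eq_bigr => t1 _.
rewrite mulr_sumr; apply: eq_bigr => t2 _.
have lt1 : (t1 <= q1)%N by rewrite -ltnS.
have lt2 : (t2 <= q2)%N by rewrite -ltnS.
rewrite coef_common_bin.
have -> : (q1 + s + (q2 - t2) = d - t2)%N by lia.
have -> : (q2 + s + (q1 - t1) = d - t1)%N by lia.
have -> : coef_second t1 t2 = ((q1 + s)`!%:R * (q2 + s)`!%:R * ((q1 - t1)`!%:R * (q2 - t2)`!%:R))^-1.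
  rewrite /coef_second -!PoszD !inv_fact_sub lt1 lt2 /=.
  by rewrite !invfM; ring.
have E : ((d - t1 - t2)`! * 'C(N, d - t1 - t2) = N ^_ s * (N - s) ^_ (q1 - t1 + (q2 - t2)))%N.
  by rewrite mulnC bin_ffact -ffactnD; congr (_ ^_ _); lia.
have {}E := congr1 (fun n => n%:R : rat) E; rewrite !natrM in E.
transitivity (p1`!%:R * p2`!%:R * ((d - t1 - t2)`!%:R * 'C(N, d - t1 - t2)%:R)
     * ('C(d - t2, t1)%:R * 'C(d - t1, t2)%:R) * 2^-1 ^+ (t1 + t2) *
   ((q1 + s)`!%:R * (q2 + s)`!%:R * ((q1 - t1)`!%:R * (q2 - t2)`!%:R))^-1 : rat); first by ring.
by rewrite E; field; rewrite !factr_neq0.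
Qed.

(** Both sides vanish at N = 0, and both grow by T(N+s) - T(N) from N to N + 1. *)
Lemma binsum_window N : binsum coef_first 1 N - binsum coef_second 1 N = \sum_(i < s) window_term (N + i).
Proof.
elim: N => [|N IH].
  rewrite !binsum0 subr0 big1 // => i _.
  by rewrite /window_term add0n ffact_small // invr0 mulr0.
rewrite !binsumS binsum_first binsum_second.
transitivity (\sum_(i < s.+1) window_term (N + i) - window_term N).
  by rewrite big_ord_recr /= -IH; ring.
rewrite big_ord_recl addn0 addrC addKr; apply: eq_bigr => i _.
by rewrite /= /bump addnS addSn.
Qed.
End Target.

(** * Evaluation of the hook sum at integers *)

(** With E the shift, this is (1-E)^q (1-E) = (1-E)^(q+1). *)
Lemma alt_bin_telescope q (u : nat -> rat) :
  \sum_(j < q.+1) 'C(q, j)%:R * (-1) ^+ j * (u j - u j.+1) =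
  \sum_(j < q.+2) 'C(q.+1, j)%:R * (-1) ^+ j * u j.
Proof.
have -> : \sum_(j < q.+1) 'C(q, j)%:R * (-1) ^+ j * (u j - u j.+1) =
   \sum_(j < q.+2) 'C(q, j)%:R * (-1) ^+ j * u j
   + \sum_(j < q.+1) 'C(q, j)%:R * (-1) ^+ j.+1 * u j.+1.
  rewrite [X in _ = X + _]big_ord_recr /= bin_small // !mul0r addr0 -big_split.
  by apply: eq_bigr => j _ /=; rewrite exprS; ring.
rewrite [RHS]big_ord_recl [in LHS]big_ord_recl /= !bin0 -addrA; congr (_ + _).
rewrite -big_split; apply: eq_bigr => j _ /=.
by rewrite /bump /= add1n binS natrD; ring.
Qed.

(** The two content factors in [pair_step] extend [rise] or [fall] by two, so on weights multiplied
    by the contents a deletion acts as 1 - E^2, with E the shift of the leg length. *)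
Lemma pair_iterE (x : rat) n q g b : (b <= n)%N ->
  pair_iter x n q g b * (rise x (n - b) * fall x b) =
  \sum_(j < q.+1) 'C(q, j)%:R * (-1) ^+ j *
    (g (b + j.*2)%N * (rise x (n + q.*2 - (b + j.*2)) * fall x (b + j.*2))).
Proof.
move=> bn; elim: q g => [|q IH] g.
  by rewrite big_ord_recl big_ord0 /= !addn0 addr0 !mul1r.
rewrite /= IH -(alt_bin_telescope q (fun j => g (b + j.*2)%N *
   (rise x (n + q.+1.*2 - (b + j.*2)) * fall x (b + j.*2)))).
apply: eq_bigr => j _; congr (_ * _).
set m := (n + q.*2)%N; set c := (b + j.*2)%N.
have cm : (c <= m)%N by rewrite /c /m leq_add // leq_double -ltnS.
have -> : (n + q.+1.*2 - c = (m - c).+2)%N by rewrite doubleS !addnS -/m !subSn // ltnW.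
have -> : (b + j.+1.*2 = c.+2)%N by rewrite doubleS !addnS.
have -> : (n + q.+1.*2 - c.+2 = m - c)%N by rewrite doubleS !addnS -/m !subSS.
by rewrite /pair_step /rise /fall !big_ord_recr /=; ring.
Qed.

(** The factors are the consecutive integers from N - b to N + a; for b >= N both sides are 0. *)
Lemma rise_fall (N a b : nat) :
  N%:R * (rise N%:R a * fall N%:R b) = ((N + a) ^_ (a + b).+1)%:R.
Proof.
rewrite mulrA; elim: b => [|b IH].
  rewrite /fall big_ord0 mulr1 addn0; elim: a => [|a IH].
    by rewrite /rise big_ord0 mulr1 addn0 ffactn1.
  rewrite /rise big_ord_recr /= mulrA -/(rise _ _) IH.
  by rewrite [in RHS]addnS ffactSS natrM mulrC -addnS natrD.
rewrite /fall big_ord_recr /= mulrA -/(fall _ _) IH addnS [in RHS]ffactnSr natrM.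
have [Nb|Nb] := leqP N b.
  by rewrite ffact_small ?mul0r // addnC ltnS leq_add2l.
rewrite -addnS (addnC N) subnDl; congr (_ * _).
by rewrite natrB.
Qed.

(** Steps of 2 in the leg length keep the sign (-1)^b, and each content product times N is (2q+n+1)!
    times a binomial; [altsum_hcoef] sums these. *)
Lemma pair_iter_hcoef (N n q b : nat) : (b <= n)%N ->
  N%:R * (pair_iter N%:R n q altsgn b * (rise N%:R (n - b) * fall N%:R b)) =
  (-1) ^+ b * (2 * q + n.+1)`!%:R * 2 ^+ q * hcoef (q + n.+1) q (N + (n - b)).
Proof.
move=> bn; rewrite pair_iterE // mulr_sumr -mulrA -altsum_hcoef mulr_sumr.
apply: eq_bigr => j _; have jq : (j <= q)%N by rewrite -ltnS.
transitivity ('C(q, j)%:R * (-1) ^+ j * altsgn (b + j.*2) *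
  (N%:R * (rise N%:R (n + q.*2 - (b + j.*2)) * fall N%:R (b + j.*2)))); first by ring.
rewrite rise_fall.
have -> : ((n + q.*2 - (b + j.*2) + (b + j.*2)).+1 = q.*2 + n.+1)%N by lia.
have -> : (N + (n + q.*2 - (b + j.*2)) = N + (n - b) + (q - j).*2)%N by lia.
rewrite -bin_ffact natrM mul2n /altsgn exprD -mul2n exprM sqrrN !expr1n mulr1.
by ring.
Qed.

(** With n = s - 1, the hook of leg b gives the window term i = n - b, and its content product times
    N is [(N + i) ^_ s]. The hook sum has this product once, but [pair_iter_hcoef] uses it for each
    row; hence the division, possible because N >= s. The signs (-1)^b of the two rows cancel. *)
Lemma hook_total_window (N q1 q2 s : nat) : (0 < s)%N -> (s <= N)%N ->
  hook_total N%:R s.-1 q1 q2 * N%:R =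
  (q1`! * q2`! * 2 ^ (q1 + q2))%:R * \sum_(i < s) window_term q1 q2 s (N + i).
Proof.
case: s => // n _ nN /=; rewrite (reindex_inj rev_ord_inj) /= mulr_suml mulr_sumr.
apply: eq_bigr => b _; rewrite subSS; have bn : (b <= n)%N by rewrite -ltnS.
have W : ((N + (n - b)) ^_ n.+1)%:R = N%:R * (rise N%:R (n - b) * fall N%:R b) :> rat.
  by rewrite rise_fall subnK.
have W0 : ((N + (n - b)) ^_ n.+1)%:R != 0 :> rat.
  by rewrite pnatr_eq0 -lt0n ffact_gt0 (leq_trans nN) // leq_addr.
rewrite /window_term /=; move: W W0; move: ((N + (n - b)) ^_ n.+1)%:R => c W W0; apply: (mulIf W0).
transitivity ((N%:R * (pair_iter N%:R n q1 altsgn b * (rise N%:R (n - b) * fall N%:R b))) *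
  (N%:R * (pair_iter N%:R n q2 altsgn b * (rise N%:R (n - b) * fall N%:R b)))).
  by rewrite W; ring.
rewrite !pair_iter_hcoef // !natrM natrX exprD.
have sq : (-1) ^+ b * (-1) ^+ b = 1 :> rat by rewrite -expr2 sqrr_sign.
transitivity (((-1) ^+ b * (-1) ^+ b) * ((2 * q1 + n.+1)`!%:R * (2 * q2 + n.+1)`!%:R *
  (2 ^+ q1 * 2 ^+ q2) * (hcoef (q1 + n.+1) q1 (N + (n - b)) * hcoef (q2 + n.+1) q2 (N + (n - b)))) : rat).
  by ring.
by rewrite sq; field; rewrite W0 !factr_neq0.
Qed.

Lemma gen_series_window (N q1 q2 s : nat) : (0 < s)%N -> (s <= N)%N ->
  (gen_series q1 q2 s).[N%:R] = \sum_(i < s) window_term q1 q2 s (N + i).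
Proof.
move=> s0 sN; have N0 : N%:R != 0 :> rat.
  by rewrite pnatr_eq0 -lt0n (leq_trans s0).
have c0 : (q1`! * q2`! * 2 ^ (q1 + q2))%:R != 0 :> rat.
  by rewrite pnatr_eq0 -lt0n !muln_gt0 !fact_gt0 expn_gt0.
by apply: (mulfI c0); rewrite -hook_total_window // -gen_series_hook // mulrC.
Qed.

Lemma poly_eq_nat (p q : {poly rat}) s :
  (forall N : nat, (s <= N)%N -> p.[N%:R] = q.[N%:R]) -> p = q.
Proof.
move=> pq; apply/eqP; rewrite -subr_eq0; apply/negPn/negP => r0.
pose rs : seq rat := [seq (s + i)%:R | i <- iota 0 (size (p - q)%R)].
suff : (size rs < size (p - q)%R)%N by rewrite size_map size_iota ltnn.
apply: max_poly_roots r0 _ _.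
- by apply/allP => _ /mapP[i _ ->]; rewrite rootE hornerD hornerN pq ?subrr // leq_addr.
- rewrite map_inj_uniq ?iota_uniq // => i j /eqP; rewrite eqr_nat eqn_add2l.
  by move/eqP.
Qed.

Unset Implicit Arguments.

(* The natural-number subtractions d - t1, d - t2 are exact on the summation
   range; the index of binom_poly truncates only when d - t1 - t2 < 0, where
   the factor 1 / (d - t1 - t2)! is 0. *)
Theorem mainTheorem1 (q1 q2 s : nat) (hs : (1 <= s)%N) :
  let d := (q1 + q2 + s)%N in
  gen_series q1 q2 s =
  \sum_(0 <= t1 < (q1 + s).+1) \sum_(0 <= t2 < (q2 + s).+1)
    (((d - t1)`!%:R * (d - t2)`!%:R * (2 * q1 + s)`!%:R * (2 * q2 + s)`!%:R
        / (2 ^+ (t1 + t2) * t1`!%:R * t2`!%:R)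
        * inv_fact (d%:Z - t1%:Z - t2%:Z))
     * (inv_fact q1 * inv_fact q2
          * inv_fact (s%:Z + q1%:Z - t1%:Z) * inv_fact (s%:Z + q2%:Z - t2%:Z)
        - inv_fact (q1%:Z + s%:Z) * inv_fact (q2%:Z + s%:Z)
          * inv_fact (q1%:Z - t1%:Z) * inv_fact (q2%:Z - t2%:Z)))
    *: binom_poly (d - t1 - t2 + 1)%N.
Proof.
move=> d; apply: (@poly_eq_nat _ _ s) => N sN.
rewrite gen_series_window // -binsum_window -sumrB big_mkord horner_sum.
apply: eq_bigr => t1 _; rewrite -sumrB big_mkord horner_sum.
apply: eq_bigr => t2 _; rewrite hornerZ horner_binom_poly -mulrBl -mulrBr.
by [].
Qed.
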